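(* Let $f$ be a concave-convex flux, $\alpha>0$, $p\ge0$. Let $\varphi^\flat_{\alpha,p}$ be the kinetic function associated with traveling waves of $$u_t+f(u)_x=\alpha\big(|u_x|^p\,u_x\big)_x+u_{xxx},$$ and, for $0\le p\le1/3$, let $A^\natural_p$ be the associated threshold function (definitions in the context). Then the derivative $(\varphi^\flat_{\alpha,p})'(0)$ exists and: (a) if $p=0$: $(\varphi^\flat_{\alpha,0})'(0)=(\varphi^\natural)'(0)=-1/2$, and the one-sided derivatives $(A^\natural_0)'(0\pm)$ exist and are nonzero; (b) if $0<p\le1/3$: $(\varphi^\flat_{\alpha,p})'(0)=-1/2$ and $\lim_{u\to0\pm}A^\natural_p(u)/|u|=+\infty$; (c) if $1/3<p<1/2$: $(\varphi^\flat_{\alpha,p})'(0)=-1/2$; (d) if $p=1/2$: $(\varphi^\flat_{\alpha,1/2})'(0)\in(-1,-1/2)$, with $\lim_{\alpha\to0+}(\varphi^\flat_{\alpha,1/2})'(0)=-1$ and $\lim_{\alpha\to+\infty}(\varphi^\flat_{\alpha,1/2})'(0)=-1/2$; (e) if $p>1/2$: $(\varphi^\flat_{\alpha,p})'(0)=-1$.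
   Context: A flux $f\in C^3(\mathbb{R})$ is concave-convex if $u\,f''(u)>0$ for $u\neq0$, $f'''(0)\neq0$, and $f'(u)\to+\infty$ as $u\to\pm\infty$. The tangent function $\varphi^\natural$: $\varphi^\natural(0)=0$ and for $u\neq0$, $\varphi^\natural(u)\ne u$ with $f'(\varphi^\natural(u))=\frac{f(u)-f(\varphi^\natural(u))}{u-\varphi^\natural(u)}$. A traveling wave connecting $u_-$ to $u_+\neq u_-$ is a $C^2$ function $w$ with $w(\pm\infty)=u_\pm$, $w'(\pm\infty)=0$, solving $$-\lambda(w-u_-)+f(w)-f(u_-)=\alpha|w'|^pw'+w''$$ with $\lambda=\frac{f(u_+)-f(u_-)}{u_+-u_-}$. The kinetic function $\varphi^\flat_{\alpha,p}:\mathbb{R}\to\mathbb{R}$ is the (unique) function such that, for $u\neq0$, $\varphi^\flat_{\alpha,p}(u)$ is the unique endpoint $u_+$ on the opposite side of $0$ from $u$, beyond or at $\varphi^\natural(u)$, reachable from $u$ by a traveling wave; $\varphi^\flat_{\alpha,p}(0)=0$. For $0\le p\le 1/3$, $A^\natural_p:\mathbb{R}\to[0,\infty)$ is the continuous function with $A^\natural_p(0)=0$ such that for $u\ne0$, $\varphi^\flat_{\alpha,p}(u)=\varphi^\natural(u)$ if and only if $\alpha\ge A^\natural_p(u)$. *)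

(* Defs.v *)
From Stdlib Require Export Reals.
Open Scope R_scope.

Definition lim_pinf (g : R -> R) (l : R) : Prop :=
  forall eps, 0 < eps -> exists N, forall x, N <= x -> Rabs (g x - l) < eps.
Definition lim_minf (g : R -> R) (l : R) : Prop :=
  forall eps, 0 < eps -> exists N, forall x, x <= N -> Rabs (g x - l) < eps.
Definition lim_0right (g : R -> R) (l : R) : Prop :=
  forall eps, 0 < eps -> exists delta, 0 < delta /\
    forall x, 0 < x < delta -> Rabs (g x - l) < eps.
Definition lim_0left (g : R -> R) (l : R) : Prop :=
  forall eps, 0 < eps -> exists delta, 0 < delta /\
    forall x, - delta < x < 0 -> Rabs (g x - l) < eps.
Definition to_pinf_0right (g : R -> R) : Prop :=
  forall M, exists delta, 0 < delta /\ forall x, 0 < x < delta -> M < g x.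
Definition to_pinf_0left (g : R -> R) : Prop :=
  forall M, exists delta, 0 < delta /\ forall x, - delta < x < 0 -> M < g x.

Definition C3_with (f f1 f2 f3 : R -> R) : Prop :=
  (forall x, derivable_pt_lim f x (f1 x)) /\
  (forall x, derivable_pt_lim f1 x (f2 x)) /\
  (forall x, derivable_pt_lim f2 x (f3 x)) /\
  continuity f3.

Definition concave_convex (f f1 f2 f3 : R -> R) : Prop :=
  C3_with f f1 f2 f3 /\
  (forall u, u <> 0 -> u * f2 u > 0) /\
  f3 0 <> 0 /\
  (forall M, exists N, forall u, N <= u -> M < f1 u) /\
  (forall M, exists N, forall u, u <= N -> M < f1 u).

Definition is_tangent (f f1 : R -> R) (phin : R -> R) : Prop :=
  phin 0 = 0 /\
  forall u, u <> 0 -> phin u <> u /\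
    f1 (phin u) = (f u - f (phin u)) / (u - phin u).

Definition spow (v p : R) : R :=
  if Req_EM_T v 0 then 0 else Rpower (Rabs v) p * v.

Definition traveling_wave (f : R -> R) (alpha p um up : R) (w : R -> R) : Prop :=
  exists w1 w2 : R -> R,
    (forall x, derivable_pt_lim w x (w1 x)) /\
    (forall x, derivable_pt_lim w1 x (w2 x)) /\
    continuity w2 /\
    lim_minf w um /\ lim_pinf w up /\
    lim_minf w1 0 /\ lim_pinf w1 0 /\
    forall x,
      - ((f up - f um) / (up - um)) * (w x - um) + f (w x) - f um
      = alpha * spow (w1 x) p + w2 x.

Definition reachable (f : R -> R) (alpha p um up : R) : Prop :=
  up <> um /\ exists w, traveling_wave f alpha p um up w.

Definition beyond (phin : R -> R) (u v : R) : Prop :=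
  u * v < 0 /\ ((0 < u /\ v <= phin u) \/ (u < 0 /\ phin u <= v)).

Definition is_kinetic (f phin : R -> R) (alpha p : R) (phik : R -> R) : Prop :=
  phik 0 = 0 /\
  forall u, u <> 0 ->
    beyond phin u (phik u) /\ reachable f alpha p u (phik u) /\
    (forall v, beyond phin u v -> reachable f alpha p u v -> v = phik u).

Definition is_threshold (phin : R -> R) (phik : R -> R -> R) (A : R -> R) : Prop :=
  A 0 = 0 /\ continuity A /\ (forall u, 0 <= A u) /\
  forall u, u <> 0 -> forall alpha, 0 < alpha ->
    (phik alpha u = phin u <-> A u <= alpha).

(* Main.v *)
(** In the variables [t = w / h], [y = - w' / h^2] with [h = |u|], a traveling wave leaving [u]
    becomes an orbit of [y y' = F + a y^(p+1)] on an interval [(s, 1)], with [y] vanishing at both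
    ends; here [s] is the ratio of the endpoints, [a = alpha h^(2p-1)], and [F] tends to the cubic
    [k (t - 1) (t - s) (t + 1 + s)], [6 k] being the third derivative of [f] at 0, as [h] tends
    to 0.  So the friction becomes dominant for [p < 1/2], negligible for [p > 1/2], and remains
    fixed for [p = 1/2].  The energy balance of the orbit (the integral of [F] is minus the
    dissipation) forces [s] to -1/2 when [a] is large and to -1 when [a] is small.  For [p = 1/2]
    two orbits of nearby systems have nearby ends, because the difference of their energies grows
    as long as it is positive; hence [s] is Cauchy as [h] tends to 0.  For [p = 0] the critical
    friction [a = (3/2) sqrt (k/2)] is read off an explicit parabolic orbit of the cubic; since
    then [a = alpha / h], this is the slope of the threshold function at 0. *)

Require Import Defs.
From Stdlib Require Import Reals Lra Classical ClassicalEpsilon.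
From Coquelicot Require Import Coquelicot.
Open Scope R_scope.

(** * Real analysis *)

(** The two limit slopes are roots of factors met in the cubic case: tangency at the lower end reads
    [1 + 2 s = 0], and the vanishing of the integral of the cubic over [(s, 1)] reads [1 + s = 0].
    No orbit is constructed and no convergence of orbits is used. The waves come with the kinetic
    function, and each limit follows from an estimate on orbits that holds once [F] is within [eta]
    of the cubic; how small [h] must be depends on [eta] alone. This uniformity in [alpha] matters
    for the threshold, where [alpha] itself shrinks like [h]. Two difficulties shape the
    intermediate notions. A wave is not assumed monotone, so it has to be shown to decrease, through
    its energy, before its speed is a function of [t]. And whether [s] is exactly the tangency ratio
    cannot be decided from a force known up to an error, so the sign of [F] is carried along as an
    exact statement. *)

Lemma dpl_continuity_pt (f : R -> R) (x l : R) :
  derivable_pt_lim f x l -> continuity_pt f x.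
Proof. intros H; apply derivable_continuous_pt; exists l; exact H. Qed.

Lemma dpl_ext (f g : R -> R) (x l m : R) :
  derivable_pt_lim f x l -> (forall t, f t = g t) -> l = m -> derivable_pt_lim g x m.
Proof.
  intros H E <-. apply is_derive_Reals. apply is_derive_ext with f; [exact E|].
  now apply is_derive_Reals.
Qed.

Lemma dpl_ext_loc (f g : R -> R) (a b x l : R) :
  a < x < b -> (forall t, a < t < b -> f t = g t) ->
  derivable_pt_lim f x l -> derivable_pt_lim g x l.
Proof.
  intros Hx E H. apply is_derive_Reals. apply is_derive_ext_loc with f.
  - exists (mkposreal (Rmin (x - a) (b - x)) ltac:(apply Rmin_pos; lra)).
    intros t Ht. apply E. unfold ball in Ht; simpl in Ht.
    unfold AbsRing_ball, abs, minus, plus, opp in Ht; simpl in Ht.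
    apply Rabs_def2 in Ht.
    pose proof (Rmin_l (x - a) (b - x)); pose proof (Rmin_r (x - a) (b - x)); lra.
  - now apply is_derive_Reals.
Qed.

Lemma mvt_open (f df : R -> R) (a b : R) :
  a < b ->
  (forall x, a < x < b -> derivable_pt_lim f x (df x)) ->
  (forall x, a <= x <= b -> continuity_pt f x) ->
  exists c, a < c < b /\ f b - f a = df c * (b - a).
Proof.
  intros Hab Hd Hc.
  destruct (MVT f id a b (fun c P => exist _ (df c) (Hd c P))
              (fun c _ => exist _ 1 (derivable_pt_lim_id c)) Hab Hc) as (c & P & E).
  - intros c _; apply derivable_continuous_pt, derivable_pt_id.
  - exists c; split; [exact P|]. simpl in E. unfold id in E. lra.
Qed.

Lemma nondecreasing_of_deriv (f df : R -> R) (a b : R) :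
  a <= b ->
  (forall x, a < x < b -> derivable_pt_lim f x (df x)) ->
  (forall x, a <= x <= b -> continuity_pt f x) ->
  (forall x, a < x < b -> 0 <= df x) -> f a <= f b.
Proof.
  intros [Hab| ->] Hd Hc Hp; [|lra].
  destruct (mvt_open f df a b Hab Hd Hc) as (c & Pc & E).
  pose proof (Rmult_le_pos _ (b - a) (Hp c Pc)); lra.
Qed.

Lemma increasing_of_deriv (f df : R -> R) (a b : R) :
  a < b ->
  (forall x, a < x < b -> derivable_pt_lim f x (df x)) ->
  (forall x, a <= x <= b -> continuity_pt f x) ->
  (forall x, a < x < b -> 0 < df x) -> f a < f b.
Proof.
  intros Hab Hd Hc Hp.
  destruct (mvt_open f df a b Hab Hd Hc) as (c & Pc & E).
  pose proof (Rmult_lt_0_compat _ (b - a) (Hp c Pc)); lra.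
Qed.

Lemma deriv_pos_local (g : R -> R) (x l : R) :
  derivable_pt_lim g x l -> 0 < l ->
  exists d, 0 < d /\ forall h, 0 < h < d -> g (x - h) < g x < g (x + h).
Proof.
  intros H Hl. destruct (H l Hl) as [d Hd]. exists d. split; [apply cond_pos|].
  intros h Hh. split.
  - assert (A := Hd (- h) ltac:(lra) ltac:(rewrite Rabs_left; lra)).
    apply Rabs_def2 in A. replace (x + - h) with (x - h) in A by ring.
    assert (0 < (g (x - h) - g x) / - h) by lra.
    pose proof (Rmult_lt_0_compat h _ (proj1 Hh) H0).
    assert (g (x - h) - g x = - (h * ((g (x - h) - g x) / - h))) by (field; lra). lra.
  - assert (A := Hd h ltac:(lra) ltac:(rewrite Rabs_right; lra)).
    apply Rabs_def2 in A.
    assert (0 < (g (x + h) - g x) / h) by lra.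
    pose proof (Rmult_lt_0_compat h _ (proj1 Hh) H0).
    assert (g (x + h) - g x = h * ((g (x + h) - g x) / h)) by (field; lra). lra.
Qed.

Lemma deriv_neg_local (g : R -> R) (x l : R) :
  derivable_pt_lim g x l -> l < 0 ->
  exists d, 0 < d /\ forall h, 0 < h < d -> g (x + h) < g x < g (x - h).
Proof.
  intros H Hl.
  destruct (deriv_pos_local (fun t => - g t) x (- l)) as (d & Hd & D).
  - apply derivable_pt_lim_opp; exact H.
  - lra.
  - exists d; split; [exact Hd|]. intros h Hh; specialize (D h Hh); lra.
Qed.

Lemma continuity_pt_pos_local (g : R -> R) (x c : R) :
  continuity_pt g x -> c < g x ->
  exists d, 0 < d /\ forall y, Rabs (y - x) < d -> c < g y.
Proof.
  intros H Hc. apply continuity_pt_locally with (eps := mkposreal (g x - c) ltac:(lra)) in H.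
  destruct H as [d Hd]. exists d; split; [apply cond_pos|].
  intros y Hy. specialize (Hd y Hy). simpl in Hd. apply Rabs_def2 in Hd. lra.
Qed.

Lemma first_zero (d : R -> R) (a b : R) :
  a < b -> (forall x, a <= x <= b -> continuity_pt d x) -> 0 < d a -> d b <= 0 ->
  exists c, a < c <= b /\ d c <= 0 /\ forall x, a <= x < c -> 0 < d x.
Proof.
  intros Hab Hc Ha Hb.
  set (S := fun t => a <= t <= b /\ forall x, a <= x <= t -> 0 < d x).
  destruct (completeness S) as [c [Hu Hl]].
  - exists b. intros t [Ht _]; lra.
  - exists a. split; [lra|]. intros x Hx. replace x with a by lra. exact Ha.
  - assert (Hac : a <= c).
    { apply Hu. split; [lra|]. intros x Hx; replace x with a by lra; exact Ha. }
    assert (Hcb : c <= b) by (apply Hl; intros t [Ht _]; lra).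
    assert (Hbelow : forall x, a <= x < c -> 0 < d x).
    { intros x Hx. apply NNPP; intros N.
      assert (c <= x); [|lra]. apply Hl. intros t [Ht Hp].
      destruct (Rle_lt_dec t x); [lra|]. exfalso; apply N, Hp; lra. }
    assert (Hdc : d c <= 0).
    { destruct (Rle_lt_dec (d c) 0) as [|Hpos]; [assumption|exfalso].
      destruct (continuity_pt_pos_local d c 0 (Hc c ltac:(lra)) Hpos) as (r & Hr & Hloc).
      assert (c < b) by (destruct Hcb as [|E]; [assumption|subst; lra]).
      set (t := Rmin b (c + r / 2)).
      assert (Ht : c < t <= b /\ t <= c + r / 2).
      { unfold t; repeat split; try apply Rmin_l; try apply Rmin_r.
        apply Rmin_glb_lt; lra. }
      assert (t <= c); [|lra]. apply Hu. split; [lra|]. intros x Hx.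
      destruct (Rlt_le_dec x c); [apply Hbelow; lra|].
      apply Hloc. apply Rabs_def1; lra. }
    exists c. repeat split; try assumption.
    destruct Hac as [|E]; [assumption|subst; lra].
Qed.

(** The derivative is controlled only where [d] is positive. That is enough: up to its first zero
    [d] is nondecreasing, hence at least [d a], so the zero does not exist. The comparisons of
    orbits reduce to this. *)
Lemma pos_persists (d dd : R -> R) (a b : R) :
  a <= b ->
  (forall x, a < x < b -> derivable_pt_lim d x (dd x)) ->
  (forall x, a <= x <= b -> continuity_pt d x) ->
  (forall x, a < x < b -> 0 < d x -> 0 <= dd x) ->
  0 < d a -> 0 < d b.
Proof.
  intros [Hab| <-] Hd Hc Hp Ha; [|exact Ha].
  destruct (Rlt_le_dec 0 (d b)) as [|Hb]; [assumption|exfalso].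
  destruct (first_zero d a b Hab Hc Ha Hb) as (c & Hcc & Hdc & Hpos).
  assert (d a <= d c); [|lra].
  apply nondecreasing_of_deriv with dd; try lra.
  - intros x Hx; apply Hd; lra.
  - intros x Hx; apply Hc; lra.
  - intros x Hx. apply Hp; [lra|]. apply Hpos; lra.
Qed.

(** * Phase plane of a traveling wave *)

Lemma spow_mul_nonneg (v p : R) : 0 <= spow v p * v.
Proof.
  unfold spow. destruct (Req_EM_T v 0) as [->|H]; [lra|].
  unfold Rpower. pose proof (exp_pos (p * ln (Rabs v))).
  rewrite Rmult_assoc. apply Rmult_le_pos; [lra|]. apply Rle_0_sqr.
Qed.

Lemma spow_mul_pos (v p : R) : v <> 0 -> 0 < spow v p * v.
Proof.
  intros Hv. unfold spow. destruct (Req_EM_T v 0) as [->|H]; [lra|].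
  unfold Rpower. pose proof (exp_pos (p * ln (Rabs v))).
  rewrite Rmult_assoc. apply Rmult_lt_0_compat; [lra|].
  apply Rsqr_pos_lt; exact Hv.
Qed.

Set Implicit Arguments.

(** [F] is the left side of the wave equation as a function of [w], and [G] its primitive normalized
    at [u]. Keeping them abstract separates the phase-plane argument, which uses only signs, from
    the flux. *)
Record wave (F G : R -> R) (alpha p u v : R) (w w1 w2 : R -> R) : Prop := {
  wv_alpha : 0 < alpha;
  wv_lt : v < u;
  wv_G : forall x, derivable_pt_lim G x (F x);
  wv_Gu : G u = 0;
  wv_1 : forall x, derivable_pt_lim w x (w1 x);
  wv_2 : forall x, derivable_pt_lim w1 x (w2 x);
  wv_wm : lim_minf w u;
  wv_wp : lim_pinf w v;
  wv_w1m : lim_minf w1 0;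
  wv_w1p : lim_pinf w1 0;
  wv_ode : forall x, F (w x) = alpha * spow (w1 x) p + w2 x }.

Unset Implicit Arguments.

(** Mechanical energy in the potential [- G]; friction dissipates it from 0 at minus infinity to
    [- G v] at plus infinity. *)
Definition energy (G w w1 : R -> R) (x : R) : R := w1 x ^ 2 / 2 - G (w x).

Lemma energy_limit (G w w1 : R -> R) (L : R) (eps : R) :
  continuity_pt G L -> 0 < eps ->
  exists d, 0 < d /\ forall x, Rabs (w x - L) < d -> Rabs (w1 x - 0) < d ->
    Rabs (energy G w w1 x + G L) < eps.
Proof.
  intros HG He.
  apply continuity_pt_locally with (eps := mkposreal (eps / 2) ltac:(lra)) in HG.
  destruct HG as [d Hd]. simpl in Hd.
  exists (Rmin d (Rmin 1 (eps / 2))). split.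
  { repeat apply Rmin_pos; try lra. apply cond_pos. }
  intros x H1 H2.
  assert (A1 : Rabs (w x - L) < d) by (eapply Rlt_le_trans; [exact H1|apply Rmin_l]).
  assert (A2 : Rabs (w1 x - 0) < 1).
  { eapply Rlt_le_trans; [exact H2|]. eapply Rle_trans; [apply Rmin_r|apply Rmin_l]. }
  assert (A3 : Rabs (w1 x - 0) < eps / 2).
  { eapply Rlt_le_trans; [exact H2|]. eapply Rle_trans; [apply Rmin_r|apply Rmin_r]. }
  specialize (Hd (w x) A1). rewrite Rminus_0_r in *.
  assert (A4 : 0 <= w1 x ^ 2 < eps / 2).
  { rewrite <- (pow2_abs (w1 x)). pose proof (Rabs_pos (w1 x)). nra. }
  unfold energy. apply Rabs_def2 in Hd. apply Rabs_def1; lra.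
Qed.

Lemma wave_energy_deriv {F G alpha p u v w w1 w2} (W : wave F G alpha p u v w w1 w2) x :
  derivable_pt_lim (energy G w w1) x (- (alpha * (spow (w1 x) p * w1 x))).
Proof.
  destruct W as [_ _ HG _ H1 H2 _ _ _ _ Ho].
  unfold energy. apply is_derive_Reals.
  evar_last.
  - apply @is_derive_minus.
    + apply is_derive_Reals.
      apply derivable_pt_lim_ext with (fun t => / 2 * (w1 t * w1 t)); [intros z; field|].
      apply derivable_pt_lim_scal, derivable_pt_lim_mult; apply H2.
    + apply is_derive_Reals. apply (derivable_pt_lim_comp w G); [apply H1|apply HG].
  - simpl. unfold minus, plus, opp; simpl. rewrite (Ho x). field.
Qed.

Lemma wave_energy_decr {F G alpha p u v w w1 w2} (W : wave F G alpha p u v w w1 w2) x y :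
  x <= y -> energy G w w1 y <= energy G w w1 x.
Proof.
  intros Hxy. apply Ropp_le_cancel.
  apply (nondecreasing_of_deriv (fun t => - energy G w w1 t)
          (fun t => alpha * (spow (w1 t) p * w1 t))); [exact Hxy| | |].
  - intros t _. eapply dpl_ext; [apply derivable_pt_lim_opp, (wave_energy_deriv W)|reflexivity|ring].
  - intros t _. eapply dpl_continuity_pt, derivable_pt_lim_opp, (wave_energy_deriv W).
  - intros t _. apply Rmult_le_pos; [apply Rlt_le, (wv_alpha W)|apply spow_mul_nonneg].
Qed.

Lemma wave_energy_minf {F G alpha p u v w w1 w2} (W : wave F G alpha p u v w w1 w2) :
  lim_minf (energy G w w1) 0.
Proof.
  intros eps He.
  destruct (energy_limit G w w1 u eps) as (d & Hd & D);
    [eapply dpl_continuity_pt, (wv_G W)|exact He|].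
  destruct (wv_wm W Hd) as [N1 H1].
  destruct (wv_w1m W Hd) as [N2 H2].
  exists (Rmin N1 N2). intros x Hx.
  pose proof (Rmin_l N1 N2); pose proof (Rmin_r N1 N2).
  specialize (D x (H1 x ltac:(lra)) (H2 x ltac:(lra))).
  rewrite (wv_Gu W) in D.
  rewrite Rminus_0_r. rewrite Rplus_0_r in D. exact D.
Qed.

Lemma wave_energy_pinf {F G alpha p u v w w1 w2} (W : wave F G alpha p u v w w1 w2) :
  lim_pinf (energy G w w1) (- G v).
Proof.
  intros eps He.
  destruct (energy_limit G w w1 v eps) as (d & Hd & D);
    [eapply dpl_continuity_pt, (wv_G W)|exact He|].
  destruct (wv_wp W Hd) as [N1 H1].
  destruct (wv_w1p W Hd) as [N2 H2].
  exists (Rmax N1 N2). intros x Hx.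
  pose proof (Rmax_l N1 N2); pose proof (Rmax_r N1 N2).
  specialize (D x (H1 x ltac:(lra)) (H2 x ltac:(lra))).
  unfold Rminus. rewrite Ropp_involutive. exact D.
Qed.

Lemma wave_energy_bounds {F G alpha p u v w w1 w2} (W : wave F G alpha p u v w w1 w2) x :
  - G v <= energy G w w1 x <= 0.
Proof.
  split; apply Rnot_lt_le; intros H.
  - destruct (wave_energy_pinf W (- G v - energy G w w1 x)) as [N HN]; [lra|].
    specialize (HN (Rmax N x) (Rmax_l _ _)).
    pose proof (wave_energy_decr W x (Rmax N x) (Rmax_r _ _)).
    apply Rabs_def2 in HN. lra.
  - destruct (wave_energy_minf W (energy G w w1 x) H) as [N HN].
    specialize (HN (Rmin N x) (Rmin_l _ _)).
    pose proof (wave_energy_decr W (Rmin N x) x (Rmin_r _ _)).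
    apply Rabs_def2 in HN. lra.
Qed.

Lemma wave_energy_strict {F G alpha p u v w w1 w2} (W : wave F G alpha p u v w w1 w2) x :
  w1 x <> 0 -> - G v < energy G w w1 x < 0.
Proof.
  intros Hx.
  assert (Hn : - (alpha * (spow (w1 x) p * w1 x)) < 0).
  { pose proof (Rmult_lt_0_compat _ _ (wv_alpha W) (spow_mul_pos (w1 x) p Hx)). lra. }
  destruct (deriv_neg_local _ _ _ (wave_energy_deriv W x) Hn) as (d & Hd & D).
  specialize (D (d / 2) ltac:(lra)).
  pose proof (wave_energy_bounds W (x + d / 2)).
  pose proof (wave_energy_bounds W (x - d / 2)).
  lra.
Qed.

Lemma strict_max_of_second_deriv (w w1 w2 : R -> R) (x : R) :
  (forall t, derivable_pt_lim w t (w1 t)) ->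
  (forall t, derivable_pt_lim w1 t (w2 t)) ->
  w1 x = 0 -> w2 x < 0 ->
  exists d, 0 < d /\ forall h, 0 < h < d -> w (x - h) < w x /\ w (x + h) < w x.
Proof.
  intros H1 H2 E Hn.
  destruct (deriv_neg_local w1 x (w2 x) (H2 x) Hn) as (d & Hd & D).
  exists d; split; [exact Hd|]. intros h Hh. split.
  - apply increasing_of_deriv with w1; try lra; [auto|intros; eapply dpl_continuity_pt, H1|].
    intros t Ht. specialize (D (x - t) ltac:(lra)).
    replace (x - (x - t)) with t in D by ring. lra.
  - apply Ropp_lt_cancel.
    apply (increasing_of_deriv (fun t => - w t) (fun t => - w1 t)); try lra.
    + intros t _; apply derivable_pt_lim_opp, H1.
    + intros t _; eapply dpl_continuity_pt, derivable_pt_lim_opp, H1.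
    + intros t Ht. specialize (D (t - x) ltac:(lra)).
      replace (x + (t - x)) with t in D by ring. lra.
Qed.

Lemma strict_min_of_second_deriv (w w1 w2 : R -> R) (x : R) :
  (forall t, derivable_pt_lim w t (w1 t)) ->
  (forall t, derivable_pt_lim w1 t (w2 t)) ->
  w1 x = 0 -> 0 < w2 x ->
  exists d, 0 < d /\ forall h, 0 < h < d -> w x < w (x - h) /\ w x < w (x + h).
Proof.
  intros H1 H2 E Hp.
  destruct (strict_max_of_second_deriv (fun t => - w t) (fun t => - w1 t) (fun t => - w2 t) x)
    as (d & Hd & D).
  - intros t; apply derivable_pt_lim_opp, H1.
  - intros t; apply derivable_pt_lim_opp, H2.
  - lra.
  - lra.
  - exists d; split; [exact Hd|]. intros h Hh; specialize (D h Hh); lra.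
Qed.

Lemma interior_min_deriv (f : R -> R) (a b x l : R) :
  a < x < b -> (forall y, a <= y <= b -> f x <= f y) -> derivable_pt_lim f x l -> l = 0.
Proof.
  intros Hx Hm Hd. destruct (Rtotal_order l 0) as [Hl|[|Hl]]; [exfalso|assumption|exfalso].
  - destruct (deriv_neg_local f x l Hd Hl) as (d & Hdp & D).
    set (h := Rmin (d / 2) (b - x)).
    assert (0 < h <= d / 2 /\ h <= b - x).
    { unfold h; repeat split; [apply Rmin_pos; lra|apply Rmin_l|apply Rmin_r]. }
    specialize (D h ltac:(lra)). specialize (Hm (x + h) ltac:(lra)). lra.
  - destruct (deriv_pos_local f x l Hd Hl) as (d & Hdp & D).
    set (h := Rmin (d / 2) (x - a)).
    assert (0 < h <= d / 2 /\ h <= x - a).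
    { unfold h; repeat split; [apply Rmin_pos; lra|apply Rmin_l|apply Rmin_r]. }
    specialize (D h ltac:(lra)). specialize (Hm (x - h) ltac:(lra)). lra.
Qed.

Lemma interior_max_deriv (f : R -> R) (a b x l : R) :
  a < x < b -> (forall y, a <= y <= b -> f y <= f x) -> derivable_pt_lim f x l -> l = 0.
Proof.
  intros Hx Hm Hd.
  assert (- l = 0); [|lra].
  apply (interior_min_deriv (fun t => - f t) a b x); [exact Hx| |apply derivable_pt_lim_opp, Hd].
  intros y Hy; specialize (Hm y Hy); lra.
Qed.

(** [X] is only a right inverse on the values in [(a, b)], and a wave is not known to be monotone
    while it is above [u]. Hence [Hdec] compares each value in [(a, b)] with all later ones; this
    confines [X (t + h)] near [X t] without assuming [X] continuous. *)
Lemma inverse_deriv (f df X : R -> R) (a b : R) :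
  (forall t, a < t < b -> f (X t) = t) ->
  (forall x, derivable_pt_lim f x (df x)) ->
  (forall x, a < f x < b -> df x < 0) ->
  (forall x y, a < f x < b -> x < y -> f y < f x) ->
  forall t, a < t < b -> derivable_pt_lim X t (/ df (X t)).
Proof.
  intros HX Hd Hn Hdec t Ht.
  assert (Hfx : a < f (X t) < b) by (rewrite HX; assumption).
  set (x0 := X t) in *. assert (Hx0 : f x0 = t) by (apply HX; exact Ht).
  specialize (Hn x0 Hfx).
  intros eps He.
  assert (Ci : continuity_pt (fun q => / q) (df x0)).
  { apply (continuity_pt_inv id); [apply derivable_continuous_pt, derivable_pt_id|unfold id; lra]. }
  apply continuity_pt_locally with (eps := mkposreal eps He) in Ci.
  destruct Ci as [dq Hq]. simpl in Hq.
  destruct (Hd x0 dq (cond_pos dq)) as [dk Hk].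
  destruct (deriv_neg_local f x0 (df x0) (Hd x0) Hn) as (d1 & Hd1 & D1).
  destruct (continuity_pt_pos_local f x0 a (dpl_continuity_pt _ _ _ (Hd x0)) ltac:(lra))
    as (d2 & Hd2 & D2).
  set (r := Rmin dk (Rmin d1 d2) / 2).
  assert (Hr : 0 < r /\ r < dk /\ r < d1 /\ r < d2).
  { pose proof (cond_pos dk).
    assert (0 < Rmin dk (Rmin d1 d2)) by (repeat apply Rmin_pos; lra).
    pose proof (Rmin_l dk (Rmin d1 d2)). pose proof (Rmin_r dk (Rmin d1 d2)).
    pose proof (Rmin_l d1 d2). pose proof (Rmin_r d1 d2). unfold r; repeat split; lra. }
  destruct Hr as (Hr0 & Hrk & Hr1 & Hr2).
  pose proof (D1 r ltac:(lra)) as Dr.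
  assert (Da : a < f (x0 + r)).
  { apply D2. replace (x0 + r - x0) with r by ring. rewrite Rabs_right; lra. }
  (* [dh] keeps [t + h] between the values of [f] at [x0 + r] and [x0 - r], which traps [X (t + h)]
     in [(x0 - r, x0 + r)]. *)
  set (dh := Rmin (Rmin (t - a) (b - t)) (Rmin (t - f (x0 + r)) (f (x0 - r) - t))).
  assert (Hdh : 0 < dh) by (unfold dh; repeat apply Rmin_pos; lra).
  exists (mkposreal dh Hdh). intros h Hh0 Hh. simpl in Hh.
  assert (B : t + h < b /\ a < t + h /\ f (x0 + r) < t + h < f (x0 - r)).
  { apply Rabs_def2 in Hh. unfold dh in Hh.
    pose proof (Rmin_l (Rmin (t - a) (b - t)) (Rmin (t - f (x0 + r)) (f (x0 - r) - t))).
    pose proof (Rmin_r (Rmin (t - a) (b - t)) (Rmin (t - f (x0 + r)) (f (x0 - r) - t))).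
    pose proof (Rmin_l (t - a) (b - t)). pose proof (Rmin_r (t - a) (b - t)).
    pose proof (Rmin_l (t - f (x0 + r)) (f (x0 - r) - t)).
    pose proof (Rmin_r (t - f (x0 + r)) (f (x0 - r) - t)).
    repeat split; lra. }
  assert (Hf' : f (X (t + h)) = t + h) by (apply HX; lra).
  assert (Hlo : x0 - r < X (t + h)).
  { apply Rnot_le_lt; intros [Hc|Hc].
    - pose proof (Hdec (X (t + h)) (x0 - r) ltac:(lra) Hc). lra.
    - rewrite Hc in Hf'. lra. }
  assert (Hhi : X (t + h) < x0 + r).
  { apply Rnot_le_lt; intros [Hc|Hc].
    - pose proof (Hdec (x0 + r) (X (t + h)) ltac:(lra) Hc). lra.
    - rewrite <- Hc in Hf'. lra. }
  set (k := X (t + h) - x0).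
  assert (Hk0 : k <> 0).
  { intros Z. assert (X (t + h) = x0) by (unfold k in Z; lra). rewrite H in Hf'. lra. }
  specialize (Hk k Hk0 ltac:(apply Rabs_def1; unfold k; lra)).
  replace (x0 + k) with (X (t + h)) in Hk by (unfold k; ring).
  rewrite Hf', Hx0 in Hk. replace (t + h - t) with h in Hk by ring.
  specialize (Hq (h / k) Hk). fold x0. fold k.
  replace (k / h) with (/ (h / k)) by (field; split; assumption). exact Hq.
Qed.

(** * Monotonicity of the wave from its critical points *)

(** At a critical point the energy is [- G (w x)], and it is at least [- G v]. The conditions turn
    this into: no critical value lies below [v], critical points with value in [(v, u)] are strict
    maxima, those above [u] are strict minima. *)
Record wave_signs (F G : R -> R) (u v : R) : Prop := {
  ws_mid : forall t, v < t < u -> 0 <= F t -> G v < G t;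
  ws_right : forall t, u < t -> 0 < F t;
  ws_left : forall t, t < v -> G v < G t }.

Lemma spow_0 p : spow 0 p = 0.
Proof. unfold spow. destruct (Req_EM_T 0 0); [reflexivity|lra]. Qed.

Lemma crit_energy (G w w1 : R -> R) x : w1 x = 0 -> energy G w w1 x = - G (w x).
Proof. intros E; unfold energy; rewrite E; field. Qed.

Lemma crit_ge {F G alpha p u v w w1 w2} (W : wave F G alpha p u v w w1 w2)
  (S : wave_signs F G u v) x : w1 x = 0 -> v <= w x.
Proof.
  intros E. apply Rnot_lt_le; intros H.
  pose proof (ws_left _ _ _ _ S _ H). pose proof (wave_energy_bounds W x).
  rewrite (crit_energy G w w1 x E) in *. lra.
Qed.

Lemma crit_w2 {F G alpha p u v w w1 w2} (W : wave F G alpha p u v w w1 w2) x :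
  w1 x = 0 -> w2 x = F (w x).
Proof.
  intros E. rewrite (wv_ode W x), E, spow_0. ring.
Qed.

Lemma crit_concave {F G alpha p u v w w1 w2} (W : wave F G alpha p u v w w1 w2)
  (S : wave_signs F G u v) x : w1 x = 0 -> v < w x < u -> w2 x < 0.
Proof.
  intros E H. rewrite (crit_w2 W x E). apply Rnot_le_lt; intros HF.
  pose proof (ws_mid _ _ _ _ S _ H HF). pose proof (wave_energy_bounds W x).
  rewrite (crit_energy G w w1 x E) in *. lra.
Qed.

(** The energy has already reached its lower bound [- G v], so no later slope can be nonzero. This
    covers a wave that arrives at [v] in finite time. *)
Lemma wave_stays_at_end {F G alpha p u v w w1 w2} (W : wave F G alpha p u v w w1 w2) x y :
  w1 x = 0 -> w x = v -> x <= y -> w y = v.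
Proof.
  intros E Ev Hxy.
  assert (Ex : energy G w w1 x = - G v) by (rewrite (crit_energy _ _ _ _ E), Ev; reflexivity).
  assert (Z : forall t, x <= t -> w1 t = 0).
  { intros t Ht. apply NNPP; intros N. pose proof (wave_energy_strict W t N).
    pose proof (wave_energy_decr W x t Ht). lra. }
  apply Rle_antisym.
  - apply Ropp_le_cancel. rewrite <- Ev.
    apply (nondecreasing_of_deriv (fun t => - w t) (fun t => - w1 t)); [exact Hxy| | |].
    + intros t _; apply derivable_pt_lim_opp, (wv_1 W).
    + intros t _; eapply dpl_continuity_pt, derivable_pt_lim_opp, (wv_1 W).
    + intros t Ht; rewrite Z; lra.
  - rewrite <- Ev.
    apply (nondecreasing_of_deriv w w1); [exact Hxy| | |].
    + intros t _; apply (wv_1 W).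
    + intros t _; eapply dpl_continuity_pt, (wv_1 W).
    + intros t Ht; rewrite Z; lra.
Qed.

Lemma wave_cont {F G alpha p u v w w1 w2} (W : wave F G alpha p u v w w1 w2) : continuity w.
Proof. intros x; eapply dpl_continuity_pt, (wv_1 W). Qed.

Lemma wave_left_above {F G alpha p u v w w1 w2} (W : wave F G alpha p u v w w1 w2) c x :
  c < u -> exists a, a < x /\ c < w a.
Proof.
  intros Hc. destruct (wv_wm W (eps := u - c)) as [N HN]; [lra|].
  exists (Rmin N (x - 1)). split; [pose proof (Rmin_r N (x - 1)); lra|].
  specialize (HN _ (Rmin_l N (x - 1))). apply Rabs_def2 in HN. lra.
Qed.

Lemma wave_right_below {F G alpha p u v w w1 w2} (W : wave F G alpha p u v w w1 w2) c x :
  v < c -> exists b, x < b /\ w b < c.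
Proof.
  intros Hc. destruct (wv_wp W (eps := c - v)) as [N HN]; [lra|].
  exists (Rmax N (x + 1)). split; [pose proof (Rmax_r N (x + 1)); lra|].
  specialize (HN _ (Rmax_l N (x + 1))). apply Rabs_def2 in HN. lra.
Qed.

(** The wave starts higher, so a nonnegative slope at [x] yields a minimum over some [[a, x]] away
    from [a]. It is a critical point, which must either be a strict maximum or lie at [v], where the
    wave would remain. *)
Lemma wave_slope_neg {F G alpha p u v w w1 w2} (W : wave F G alpha p u v w w1 w2)
  (S : wave_signs F G u v) x : v < w x < u -> w1 x < 0.
Proof.
  intros Hx. apply Rnot_le_lt; intros Hp.
  destruct (wave_left_above W (w x) x ltac:(lra)) as (a & Ha & Hwa).
  destruct (continuity_ab_min w a x ltac:(lra) (fun c _ => wave_cont W c)) as (m & Hm & Hma).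
  pose proof (Hm x ltac:(lra)) as Hmx.
  assert (m <> a) by (intros ->; lra).
  destruct (Req_dec m x) as [->|Hne].
  - assert (E : w1 x = 0).
    { destruct Hp as [Hp|Hp]; [exfalso|lra].
      destruct (deriv_pos_local w x (w1 x) (wv_1 W x) Hp) as (d & Hd & D).
      set (h := Rmin (d / 2) (x - a)).
      assert (0 < h <= d / 2 /\ h <= x - a).
      { unfold h; repeat split; [apply Rmin_pos; lra|apply Rmin_l|apply Rmin_r]. }
      specialize (D h ltac:(lra)). specialize (Hm (x - h) ltac:(lra)). lra. }
    pose proof (crit_concave W S x E Hx) as Hn.
    destruct (strict_max_of_second_deriv w w1 w2 x (wv_1 W) (wv_2 W) E Hn) as (d & Hd & D).
    set (h := Rmin (d / 2) (x - a)).
    assert (0 < h <= d / 2 /\ h <= x - a).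
    { unfold h; repeat split; [apply Rmin_pos; lra|apply Rmin_l|apply Rmin_r]. }
    specialize (D h ltac:(lra)). specialize (Hm (x - h) ltac:(lra)). lra.
  - assert (E : w1 m = 0) by (apply (interior_min_deriv w a x m); [lra|exact Hm|apply (wv_1 W)]).
    pose proof (crit_ge W S m E) as [Hv|Hv].
    + pose proof (crit_concave W S m E ltac:(lra)) as Hn.
      destruct (strict_max_of_second_deriv w w1 w2 m (wv_1 W) (wv_2 W) E Hn) as (d & Hd & D).
      set (h := Rmin (d / 2) (x - m)).
      assert (0 < h <= d / 2 /\ h <= x - m).
      { unfold h; repeat split; [apply Rmin_pos; lra|apply Rmin_l|apply Rmin_r]. }
      specialize (D h ltac:(lra)). specialize (Hm (m + h) ltac:(lra)). lra.
    + pose proof (wave_stays_at_end W m x E (eq_sym Hv) ltac:(lra)). lra.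
Qed.

(** A return to the level [w x] gives an interior maximum. Its value cannot be below [u] (the slope
    is negative there), nor [u] (the energy would be back at 0), nor above [u] (critical points
    there are strict minima). *)
Lemma wave_decreasing {F G alpha p u v w w1 w2} (W : wave F G alpha p u v w w1 w2)
  (S : wave_signs F G u v) x y : v < w x < u -> x < y -> w y < w x.
Proof.
  intros Hx Hxy.
  destruct (wave_right_below W (w x) y ltac:(lra)) as (b & Hb & Hwb).
  destruct (continuity_ab_maj w x b ltac:(lra) (fun c _ => wave_cont W c)) as (m & Hm & Hmb).
  pose proof (Hm x ltac:(lra)) as Hmx.
  assert (m <> b) by (intros ->; lra).
  destruct (Req_dec m x) as [->|Hne].
  - destruct (Hm y ltac:(lra)) as [|Ey]; [assumption|exfalso].
    assert (E : w1 y = 0).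
    { apply (interior_max_deriv w x b y); [lra| |apply (wv_1 W)].
      intros z Hz; rewrite Ey; apply Hm; exact Hz. }
    pose proof (wave_slope_neg W S y ltac:(lra)). lra.
  - exfalso.
    assert (E : w1 m = 0) by (apply (interior_max_deriv w x b m); [lra|exact Hm|apply (wv_1 W)]).
    destruct (Rtotal_order (w m) u) as [Hu|[Hu|Hu]].
    + pose proof (wave_slope_neg W S m ltac:(lra)). lra.
    + pose proof (wave_slope_neg W S x Hx).
      pose proof (wave_energy_strict W x ltac:(lra)).
      pose proof (wave_energy_decr W x m ltac:(lra)).
      rewrite (crit_energy _ _ _ _ E), Hu, (wv_Gu W) in *. lra.
    + assert (Hp : 0 < w2 m) by (rewrite (crit_w2 W m E); apply (ws_right _ _ _ _ S); exact Hu).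
      destruct (strict_min_of_second_deriv w w1 w2 m (wv_1 W) (wv_2 W) E Hp) as (d & Hd & D).
      set (h := Rmin (d / 2) (m - x)).
      assert (0 < h <= d / 2 /\ h <= m - x).
      { unfold h; repeat split; [apply Rmin_pos; lra|apply Rmin_l|apply Rmin_r]. }
      specialize (D h ltac:(lra)). specialize (Hm (m - h) ltac:(lra)). lra.
Qed.

Lemma wave_ge {F G alpha p u v w w1 w2} (W : wave F G alpha p u v w w1 w2)
  (S : wave_signs F G u v) x : v <= w x.
Proof.
  apply Rnot_lt_le; intros H. pose proof (wv_lt W).
  destruct (wave_left_above W (w x) x ltac:(lra)) as (a & Ha & Hwa).
  destruct (wv_wp W (eps := v - w x)) as [N HN]; [lra|].
  set (b := Rmax N (x + 1)).
  assert (Hb : x < b) by (unfold b; pose proof (Rmax_r N (x + 1)); lra).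
  specialize (HN b (Rmax_l _ _)). apply Rabs_def2 in HN.
  destruct (continuity_ab_min w a b ltac:(lra) (fun c _ => wave_cont W c)) as (m & Hm & Hma).
  pose proof (Hm x ltac:(lra)) as Hmx.
  assert (m <> a) by (intros ->; lra). assert (m <> b) by (intros ->; lra).
  assert (E : w1 m = 0) by (apply (interior_min_deriv w a b m); [lra|exact Hm|apply (wv_1 W)]).
  pose proof (crit_ge W S m E). lra.
Qed.

Lemma wave_surj {F G alpha p u v w w1 w2} (W : wave F G alpha p u v w w1 w2) t :
  v < t < u -> exists x, w x = t.
Proof.
  intros Ht.
  destruct (wave_left_above W t 0 ltac:(lra)) as (a & Ha & Hwa).
  destruct (wave_right_below W t 0 ltac:(lra)) as (b & Hb & Hwb).
  destruct (IVT_gen w a b t (wave_cont W)) as (x & _ & E).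
  - rewrite Rmin_right, Rmax_left; lra.
  - exists x; exact E.
Qed.

(** This is what makes the speed tend to 0 at [v], even if [v] is reached in finite time. Otherwise
    the energy would skip the level [- G v + eps / 2] while [w > v] and take it at a point with
    [w = v]; since [w >= v], that point is critical and its energy is exactly [- G v]. *)
Lemma wave_energy_near_end {F G alpha p u v w w1 w2} (W : wave F G alpha p u v w w1 w2)
  (S : wave_signs F G u v) eps :
  0 < eps -> exists N, v < w N /\ energy G w w1 N < - G v + eps.
Proof.
  intros He. apply NNPP; intros H.
  assert (H' : forall N, v < w N -> - G v + eps <= energy G w w1 N).
  { intros N HN. apply Rnot_lt_le; intros HE. apply H. exists N; split; assumption. }
  pose proof (wv_lt W).
  destruct (wave_surj W ((u + v) / 2) ltac:(lra)) as [x0 Hx0].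
  pose proof (H' x0 ltac:(lra)) as Hex0.
  destruct (wave_energy_pinf W (eps / 2) ltac:(lra)) as [N HN].
  specialize (HN N (Rle_refl N)). apply Rabs_def2 in HN.
  destruct (IVT_gen (energy G w w1) x0 N (- G v + eps / 2)) as (x & _ & E).
  - intros z; eapply dpl_continuity_pt, (wave_energy_deriv W).
  - rewrite Rmin_right, Rmax_left; lra.
  - destruct (wave_ge W S x) as [Hx|Hx].
    + pose proof (H' x Hx). lra.
    + assert (Z : w1 x = 0).
      { apply (interior_min_deriv w (x - 1) (x + 1) x); [lra| |apply (wv_1 W)].
        intros y _. rewrite <- Hx. apply (wave_ge W S). }
      rewrite (crit_energy _ _ _ _ Z), <- Hx in E. lra.
Qed.

(* [y] is the speed [- w'] of a decreasing wave from [u] to [v], as a function of the value [t = w]. *)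
Definition orbit (F : R -> R) (a p u v : R) (y : R -> R) : Prop :=
  v < u /\ continuity y /\
  (forall t, t <= v -> y t = 0) /\ (forall t, u <= t -> y t = 0) /\
  (forall t, v < t < u -> 0 < y t) /\
  (forall t, v < t < u -> derivable_pt_lim y t (F t / y t + a * Rpower (y t) p)).

Lemma wave_orbit {F G alpha p u v w w1 w2} (W : wave F G alpha p u v w w1 w2)
  (S : wave_signs F G u v) : exists y, orbit F alpha p u v y.
Proof.
  assert (HX : exists X, forall t, v < t < u -> w (X t) = t).
  { assert (H : forall t, exists x, v < t < u -> w x = t).
    { intros t. destruct (classic (v < t < u)) as [Ht|Ht].
      - destruct (wave_surj W t Ht) as [x Hx]; exists x; auto.
      - exists 0; tauto. }
    exists (fun t => proj1_sig (constructive_indefinite_description _ (H t))).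
    intros t. exact (proj2_sig (constructive_indefinite_description _ (H t))). }
  destruct HX as [X HX].
  assert (Hneg : forall t, v < t < u -> w1 (X t) < 0).
  { intros t Ht. apply (wave_slope_neg W S). rewrite HX; assumption. }
  set (y := fun t => if Rlt_dec v t then (if Rlt_dec t u then - w1 (X t) else 0) else 0).
  assert (Yin : forall t, v < t < u -> y t = - w1 (X t)).
  { intros t Ht. unfold y. destruct (Rlt_dec v t); [destruct (Rlt_dec t u); [reflexivity|lra]|lra]. }
  assert (Yl : forall t, t <= v -> y t = 0).
  { intros t Ht. unfold y. destruct (Rlt_dec v t); [lra|reflexivity]. }
  assert (Yr : forall t, u <= t -> y t = 0).
  { intros t Ht. unfold y. destruct (Rlt_dec v t); [destruct (Rlt_dec t u); [lra|reflexivity]|reflexivity]. }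
  assert (Ypos : forall t, v < t < u -> 0 < y t).
  { intros t Ht; rewrite (Yin t Ht); specialize (Hneg t Ht); lra. }
  assert (Ysq : forall t, v < t < u -> y t ^ 2 / 2 = energy G w w1 (X t) + G t).
  { intros t Ht. rewrite (Yin t Ht). unfold energy. rewrite (HX t Ht). field. }
  assert (Yd : forall t, v < t < u ->
            derivable_pt_lim y t (F t / y t + alpha * Rpower (y t) p)).
  { intros t Ht. pose proof (Hneg t Ht) as Hn.
    apply dpl_ext_loc with (fun t => - w1 (X t)) v u; [exact Ht|intros; symmetry; auto|].
    eapply dpl_ext.
    - apply derivable_pt_lim_opp. apply (derivable_pt_lim_comp X w1).
      + apply (inverse_deriv w w1 X v u HX (wv_1 W)); [|intros a b Ha Hab; exact (wave_decreasing W S a b Ha Hab)|exact Ht].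
        intros; apply (wave_slope_neg W S); assumption.
      + apply (wv_2 W).
    - reflexivity.
    - rewrite (Yin t Ht). pose proof (wv_ode W (X t)) as Ho. rewrite (HX t Ht) in Ho.
      unfold spow in Ho. destruct (Req_EM_T (w1 (X t)) 0) as [Z|_]; [lra|].
      rewrite Rabs_left in Ho by exact Hn. rewrite Ho. field. lra. }
  pose proof (wv_lt W) as Hvu.
  (* Near [u] the energy is at most 0, so [y^2 / 2 <= G t], which tends to 0. *)
  assert (Cu : continuity_pt y u).
  { apply continuity_pt_locally. intros eps. rewrite (Yr u (Rle_refl u)).
    pose proof (cond_pos eps) as He.
    assert (CG : continuity_pt (fun t => - G t) u)
      by (eapply dpl_continuity_pt, derivable_pt_lim_opp, (wv_G W)).
    destruct (continuity_pt_pos_local _ u (- (eps ^ 2 / 2)) CG) as (d & Hd & D).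
    { rewrite (wv_Gu W). nra. }
    exists (mkposreal (Rmin d (u - v)) ltac:(apply Rmin_pos; lra)). intros t Ht.
    change (Rabs (t - u) < Rmin d (u - v)) in Ht. rewrite Rminus_0_r.
    destruct (Rle_lt_dec u t) as [Hut|Hut]; [rewrite Yr, Rabs_R0; assumption|].
    assert (Ht' : v < t < u).
    { apply Rabs_def2 in Ht. pose proof (Rmin_r d (u - v)); lra. }
    specialize (D t (Rlt_le_trans _ _ _ Ht (Rmin_l _ _))).
    pose proof (Ysq t Ht'). pose proof (wave_energy_bounds W (X t)). pose proof (Ypos t Ht').
    rewrite Rabs_right by lra. nra. }
  (* Near [v] the bound 0 on the energy is too weak; monotonicity carries the bound at the point [N]
     to every [t] below [w N]. *)
  assert (Cv : continuity_pt y v).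
  { apply continuity_pt_locally. intros eps. rewrite (Yl v (Rle_refl v)).
    pose proof (cond_pos eps) as He.
    assert (CG : continuity_pt (fun t => - G t) v)
      by (eapply dpl_continuity_pt, derivable_pt_lim_opp, (wv_G W)).
    destruct (continuity_pt_pos_local _ v (- G v - (eps ^ 2 / 4)) CG) as (d & Hd & D).
    { nra. }
    destruct (wave_energy_near_end W S (eps ^ 2 / 4)) as (N & HvN & HN); [nra|].
    set (r := Rmin d (Rmin (w N - v) (u - v))).
    assert (Hr : 0 < r /\ r <= d /\ r <= w N - v /\ r <= u - v).
    { unfold r. pose proof (Rmin_l (w N - v) (u - v)). pose proof (Rmin_r (w N - v) (u - v)).
      pose proof (Rmin_r d (Rmin (w N - v) (u - v))).
      repeat split; [repeat apply Rmin_pos; lra|apply Rmin_l|lra|lra]. }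
    exists (mkposreal r (proj1 Hr)). intros t Ht.
    change (Rabs (t - v) < r) in Ht. rewrite Rminus_0_r.
    destruct (Rle_lt_dec t v) as [Hut|Hut]; [rewrite Yl, Rabs_R0; assumption|].
    assert (Ht' : v < t < u /\ t < w N) by (apply Rabs_def2 in Ht; lra).
    destruct Ht' as [Ht' HtN].
    specialize (D t ltac:(lra)).
    assert (HXN : N <= X t).
    { apply Rnot_lt_le; intros Hc.
      pose proof (wave_decreasing W S (X t) N ltac:(rewrite HX; assumption) Hc) as HH.
      rewrite (HX t Ht') in HH. lra. }
    pose proof (wave_energy_decr W N (X t) HXN).
    pose proof (Ysq t Ht'). pose proof (Ypos t Ht').
    rewrite Rabs_right by lra. nra. }
  exists y. split; [exact Hvu|]. split.
  - intros t. destruct (Rtotal_order t v) as [Hv|[->|Hv]]; [|exact Cv|].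
    + apply dpl_continuity_pt with 0.
      apply dpl_ext_loc with (fun _ => 0) (t - 1) v; [lra|intros; symmetry; apply Yl; lra|].
      apply derivable_pt_lim_const.
    + destruct (Rtotal_order t u) as [Hu|[->|Hu]]; [|exact Cu|].
      * eapply dpl_continuity_pt, Yd; lra.
      * apply dpl_continuity_pt with 0.
        apply dpl_ext_loc with (fun _ => 0) u (t + 1); [lra|intros; symmetry; apply Yr; lra|].
        apply derivable_pt_lim_const.
  - repeat split; assumption.
Qed.

(** * Chords of a concave-convex flux *)

(** Mean values of [g1] on the two sides of [x], and one of [g2] between them. Only an interior
    value of [g2] enters, so intervals ending at the inflection point 0 are allowed. *)
Lemma convex_chord_gap (g g1 g2 : R -> R) (a x b : R) :
  (forall t, derivable_pt_lim g t (g1 t)) ->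
  (forall t, derivable_pt_lim g1 t (g2 t)) ->
  a < x < b ->
  exists c, a < c < b /\
    exists m, 0 < m /\ g a * (b - x) + g b * (x - a) - g x * (b - a) = g2 c * m.
Proof.
  intros H1 H2 Hx.
  destruct (mvt_open g g1 a x) as (c1 & P1 & E1);
    [lra|auto|intros; eapply dpl_continuity_pt, H1|].
  destruct (mvt_open g g1 x b) as (c2 & P2 & E2);
    [lra|auto|intros; eapply dpl_continuity_pt, H1|].
  destruct (mvt_open g1 g2 c1 c2) as (c & P & E);
    [lra|auto|intros; eapply dpl_continuity_pt, H2|].
  exists c; split; [lra|]. exists ((c2 - c1) * ((x - a) * (b - x))). split.
  - repeat apply Rmult_lt_0_compat; lra.
  - replace (g a) with (g x - g1 c1 * (x - a)) by lra.
    replace (g b) with (g x + g1 c2 * (b - x)) by lra.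
    replace (g1 c2) with (g1 c1 + g2 c * (c2 - c1)) by lra. ring.
Qed.

Lemma convex_lt_chord (g g1 g2 : R -> R) (a x b : R) :
  (forall t, derivable_pt_lim g t (g1 t)) ->
  (forall t, derivable_pt_lim g1 t (g2 t)) ->
  a < x < b -> (forall t, a < t < b -> 0 < g2 t) ->
  g x * (b - a) < g a * (b - x) + g b * (x - a).
Proof.
  intros H1 H2 Hx Hp. destruct (convex_chord_gap g g1 g2 a x b H1 H2 Hx) as (c & Hc & m & Hm & E).
  pose proof (Rmult_lt_0_compat _ _ (Hp c Hc) Hm). lra.
Qed.

Lemma concave_gt_chord (g g1 g2 : R -> R) (a x b : R) :
  (forall t, derivable_pt_lim g t (g1 t)) ->
  (forall t, derivable_pt_lim g1 t (g2 t)) ->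
  a < x < b -> (forall t, a < t < b -> g2 t < 0) ->
  g a * (b - x) + g b * (x - a) < g x * (b - a).
Proof.
  intros H1 H2 Hx Hp. destruct (convex_chord_gap g g1 g2 a x b H1 H2 Hx) as (c & Hc & m & Hm & E).
  pose proof (Rmult_lt_0_compat (- g2 c) _ ltac:(specialize (Hp c Hc); lra) Hm). lra.
Qed.

(** Both [g] and [- g] become convex after adding [K t^2 / 2], whose own chord gap is the right-hand
    side. The bound vanishes at both ends, as [near_cubic] demands. *)
Lemma chord_error (g g1 g2 : R -> R) (K a x b : R) :
  (forall t, derivable_pt_lim g t (g1 t)) ->
  (forall t, derivable_pt_lim g1 t (g2 t)) ->
  a <= x <= b -> (forall t, a < t < b -> Rabs (g2 t) <= K) ->
  Rabs (g x * (b - a) - (g a * (b - x) + g b * (x - a))) <= K / 2 * (x - a) * (b - x) * (b - a).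
Proof.
  intros H1 H2 [[Ha| <-] [Hb| ->]] HK.
  2,3,4: match goal with |- Rabs ?z <= ?w => replace z with 0 by ring; replace w with 0 by field end;
         rewrite Rabs_R0; lra.
  assert (H : forall e, e = 1 \/ e = -1 ->
     0 <= K / 2 * (x - a) * (b - x) * (b - a)
          + e * (g a * (b - x) + g b * (x - a) - g x * (b - a))).
  { intros e He.
    destruct (convex_chord_gap (fun t => e * g t + K / 2 * t ^ 2) (fun t => e * g1 t + K * t)
               (fun t => e * g2 t + K) a x b) as (c & Hc & m & Hm & E).
    - intros t. apply is_derive_Reals. evar_last.
      + apply @is_derive_plus; [apply is_derive_Reals, derivable_pt_lim_scal, H1|auto_derive; [exact I|reflexivity]].
      + unfold plus; simpl; field.
    - intros t. apply is_derive_Reals. evar_last.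
      + apply @is_derive_plus; [apply is_derive_Reals, derivable_pt_lim_scal, H2|auto_derive; [exact I|reflexivity]].
      + unfold plus; simpl; field.
    - lra.
    - specialize (HK c Hc). apply Rabs_le_between in HK.
      assert (0 <= e * g2 c + K) by (destruct He as [-> | ->]; lra).
      pose proof (Rmult_le_pos _ m H ltac:(lra)). rewrite <- E in H0.
      match goal with |- 0 <= ?z => match type of H0 with 0 <= ?w => replace z with w by field end end.
      exact H0. }
  pose proof (H 1 ltac:(auto)). pose proof (H (-1) ltac:(auto)).
  apply Rabs_le. lra.
Qed.

(** On the convex side, a value at most 0 before [t] would place the chord to [F u = 0], hence
    [F t], below 0. On the concave side, the chord from [F v = 0] carries positivity down to [v]. *)
Lemma positive_before_of_nonneg (F F1 F2 : R -> R) (u v t x : R) :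
  (forall t, derivable_pt_lim F t (F1 t)) -> (forall t, derivable_pt_lim F1 t (F2 t)) ->
  (forall t, t < 0 -> F2 t < 0) -> (forall t, 0 < t -> 0 < F2 t) ->
  v < 0 < u -> F v = 0 -> F u = 0 -> v < t < u -> 0 <= F t -> v < x < t -> 0 < F x.
Proof.
  intros H1 H2 Hn Hp Hvu Fv Fu Ht HFt Hx.
  assert (R0 : forall x, 0 <= x < t -> 0 < F x).
  { intros z Hz.
    pose proof (convex_lt_chord F F1 F2 z t u H1 H2 ltac:(lra) ltac:(intros; apply Hp; lra)) as C.
    rewrite Fu in C.
    assert (0 <= F t * (u - z)) by (apply Rmult_le_pos; lra).
    apply Rnot_le_lt; intros HH.
    pose proof (Rmult_le_pos (- F z) (u - t) ltac:(lra) ltac:(lra)). lra. }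
  destruct (Rle_lt_dec 0 x) as [H0|H0]; [apply R0; lra|].
  assert (Q : forall b, x < b <= 0 -> 0 <= F b -> 0 < F x).
  { intros b Hb HFb.
    pose proof (concave_gt_chord F F1 F2 v x b H1 H2 ltac:(lra) ltac:(intros; apply Hn; lra)) as C.
    rewrite Fv in C.
    assert (0 <= F b * (x - v)) by (apply Rmult_le_pos; lra).
    apply Rnot_le_lt; intros HH.
    pose proof (Rmult_le_pos (- F x) (b - v) ltac:(lra) ltac:(lra)). lra. }
  destruct (Rle_lt_dec t 0) as [Ht0|Ht0].
  - apply (Q t); lra.
  - apply (Q 0); [lra|]. apply Rlt_le, R0; lra.
Qed.

(** To the right of [u], a value [F t <= 0] would by convexity make [F] positive on [(v, u)], so
    [G v < G u = 0], against [0 <= G v]. To the left of [v], concavity and [0 <= F1 v] make [F]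
    negative. *)
Lemma cc_wave_signs (F F1 F2 G : R -> R) (u v : R) :
  (forall t, derivable_pt_lim F t (F1 t)) -> (forall t, derivable_pt_lim F1 t (F2 t)) ->
  (forall t, t < 0 -> F2 t < 0) -> (forall t, 0 < t -> 0 < F2 t) ->
  v < 0 < u -> F v = 0 -> F u = 0 -> 0 <= F1 v ->
  (forall t, derivable_pt_lim G t (F t)) -> G u = 0 -> 0 <= G v ->
  wave_signs F G u v.
Proof.
  intros H1 H2 Hn Hp Hvu Fv Fu HF1 HG Gu Gv.
  assert (Gincr : forall t, v < t -> (forall x, v < x < t -> 0 < F x) -> G v < G t).
  { intros t Ht HF. apply increasing_of_deriv with F; auto.
    intros; eapply dpl_continuity_pt, HG. }
  split.
  - intros t Ht HFt. apply Gincr; [lra|]. intros x Hx.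
    exact (positive_before_of_nonneg F F1 F2 u v t x H1 H2 Hn Hp Hvu Fv Fu Ht HFt Hx).
  - intros t Ht. apply Rnot_le_lt; intros HFt.
    assert (R0 : forall x, 0 <= x < u -> 0 < F x).
    { intros z Hz.
      pose proof (convex_lt_chord F F1 F2 z u t H1 H2 ltac:(lra) ltac:(intros; apply Hp; lra)) as C.
      rewrite Fu in C.
      pose proof (Rmult_le_pos (- F t) (u - z) ltac:(lra) ltac:(lra)).
      apply Rnot_le_lt; intros HH.
      pose proof (Rmult_le_pos (- F z) (t - u) ltac:(lra) ltac:(lra)). lra. }
    assert (G v < G u); [|lra]. apply Gincr; [lra|]. intros x Hx.
    destruct (Rle_lt_dec 0 x) as [Hx0|Hx0]; [apply R0; lra|].
    apply (positive_before_of_nonneg F F1 F2 u v 0 x); auto; try lra.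
    apply Rlt_le, R0; lra.
  - intros t Ht. apply Ropp_lt_cancel.
    apply (increasing_of_deriv (fun x => - G x) (fun x => - F x)); [exact Ht| | |].
    + intros x _; apply derivable_pt_lim_opp, HG.
    + intros x _; eapply dpl_continuity_pt, derivable_pt_lim_opp, HG.
    + intros x Hx.
      destruct (mvt_open F F1 x v) as (c & Hc & E);
        [lra|auto|intros; eapply dpl_continuity_pt, H1|].
      destruct (mvt_open F1 F2 c v) as (c' & Hc' & E');
        [lra|auto|intros; eapply dpl_continuity_pt, H2|].
      pose proof (Hn c' ltac:(lra)).
      assert (0 < F1 c).
      { pose proof (Rmult_lt_0_compat (- F2 c') (v - c) ltac:(lra) ltac:(lra)). lra. }
      pose proof (Rmult_lt_0_compat (F1 c) (v - x) ltac:(lra) ltac:(lra)). lra.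
Qed.

Lemma cc_tangent_neg (F F1 F2 : R -> R) (u v t : R) :
  (forall t, derivable_pt_lim F t (F1 t)) -> (forall t, derivable_pt_lim F1 t (F2 t)) ->
  (forall t, t < 0 -> F2 t < 0) -> (forall t, 0 < t -> 0 < F2 t) ->
  v < 0 < u -> F v = 0 -> F u = 0 -> F1 v = 0 -> v < t < u -> F t < 0.
Proof.
  intros H1 H2 Hn Hp Hvu Fv Fu HF1.
  assert (L : forall t, v < t <= 0 -> F t < 0).
  { intros x Hx.
    destruct (mvt_open F F1 v x) as (c & Hc & E);
      [lra|auto|intros; eapply dpl_continuity_pt, H1|].
    destruct (mvt_open F1 F2 v c) as (c' & Hc' & E');
      [lra|auto|intros; eapply dpl_continuity_pt, H2|].
    pose proof (Hn c' ltac:(lra)).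
    assert (F1 c < 0).
    { pose proof (Rmult_lt_0_compat (- F2 c') (c - v) ltac:(lra) ltac:(lra)). lra. }
    pose proof (Rmult_lt_0_compat (- F1 c) (x - v) ltac:(lra) ltac:(lra)). lra. }
  intros Ht. destruct (Rle_lt_dec t 0) as [H0|H0]; [apply L; lra|].
  pose proof (L 0 ltac:(lra)) as L0.
  pose proof (convex_lt_chord F F1 F2 0 t u H1 H2 ltac:(lra) ltac:(intros; apply Hp; lra)) as C.
  rewrite Fu in C.
  apply Rnot_le_lt; intros HH.
  pose proof (Rmult_le_pos (F t) (u - 0) ltac:(lra) ltac:(lra)).
  pose proof (Rmult_lt_0_compat (- F 0) (u - t) ltac:(lra) ltac:(lra)). lra.
Qed.

(** * Chord force, tangent gap and trapezoid gap *)

Lemma primitive_exists (f : R -> R) :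
  continuity f -> exists P : R -> R, forall x, derivable_pt_lim P x (f x).
Proof.
  intros Hc. exists (fun x => RInt f 0 x). intros x. apply is_derive_Reals.
  assert (C : forall z, continuous f z) by (intros z; apply continuity_pt_filterlim, Hc).
  apply (is_derive_RInt f (fun x => RInt f 0 x) 0 x); [|apply C].
  exists (mkposreal 1 Rlt_0_1). intros y _. apply (RInt_correct (V := R_CompleteNormedModule)), (ex_RInt_continuous (V := R_CompleteNormedModule)).
  intros; apply C.
Qed.

Definition chordF (f : R -> R) (u v w : R) : R :=
  - ((f v - f u) / (v - u)) * (w - u) + f w - f u.
Definition chordG (f P : R -> R) (u v w : R) : R :=
  P w - P u - f u * (w - u) - (f v - f u) / (v - u) * (w - u) ^ 2 / 2.
Definition tangent_gap (f f1 : R -> R) (u v : R) : R := f u - f v - (u - v) * f1 v.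
(** Error of the trapezoidal rule for the integral of [f] over [(v, u)]. It is the final energy of a
    wave from [u] to [v], so dissipation makes it nonpositive; its derivative in [v] is half the
    tangent gap. *)
Definition trapezoid_gap (f P : R -> R) (u v : R) : R := P u - P v - (u - v) * (f u + f v) / 2.

Lemma chordF_deriv f f1 u v :
  (forall t, derivable_pt_lim f t (f1 t)) ->
  forall t, derivable_pt_lim (chordF f u v) t (f1 t - (f v - f u) / (v - u)).
Proof.
  intros H t. set (l := (f v - f u) / (v - u)).
  apply dpl_ext with (f := fun x => f x + (- l * (x - u) - f u)) (l := f1 t + - l).
  - apply derivable_pt_lim_plus; [apply H|]. apply is_derive_Reals; auto_derive; [exact I|ring].
  - intros x. unfold chordF. fold l. ring.
  - ring.
Qed.

Lemma chordG_deriv f P u v :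
  (forall t, derivable_pt_lim P t (f t)) ->
  forall t, derivable_pt_lim (chordG f P u v) t (chordF f u v t).
Proof.
  intros H t. unfold chordF, chordG. set (l := (f v - f u) / (v - u)).
  eapply dpl_ext with (f := fun x => P x + (- P u - f u * (x - u) - l * (x - u) ^ 2 / 2)).
  - apply derivable_pt_lim_plus; [apply H|]. apply is_derive_Reals; auto_derive; [exact I|reflexivity].
  - intros x. ring.
  - field.
Qed.

Lemma chordF_left f u v : v <> u -> chordF f u v v = 0.
Proof. intros; unfold chordF; field; lra. Qed.
Lemma chordF_right f u v : chordF f u v u = 0.
Proof. unfold chordF; ring. Qed.
Lemma chordG_right f P u v : chordG f P u v u = 0.
Proof. unfold chordG. generalize ((f v - f u) / (v - u)); intros l; field. Qed.
Lemma chordG_left f P u v : v <> u -> chordG f P u v v = - trapezoid_gap f P u v.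
Proof. intros; unfold chordG, trapezoid_gap; field; lra. Qed.

Lemma tangent_gap_deriv f f1 f2 u :
  (forall t, derivable_pt_lim f t (f1 t)) -> (forall t, derivable_pt_lim f1 t (f2 t)) ->
  forall v, derivable_pt_lim (tangent_gap f f1 u) v (- (u - v) * f2 v).
Proof.
  intros H1 H2 v. unfold tangent_gap.
  eapply dpl_ext with (f := fun x => f u + (- f x) + (- ((u - x) * f1 x))).
  - apply derivable_pt_lim_plus.
    + apply derivable_pt_lim_plus; [apply derivable_pt_lim_const|apply derivable_pt_lim_opp, H1].
    + apply derivable_pt_lim_opp, (derivable_pt_lim_mult (fun x => u - x)); [|apply H2].
      apply is_derive_Reals; auto_derive; [exact I|reflexivity].
  - intros; ring.
  - ring.
Qed.

Lemma trapezoid_gap_deriv f f1 P u :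
  (forall t, derivable_pt_lim f t (f1 t)) -> (forall t, derivable_pt_lim P t (f t)) ->
  forall v, derivable_pt_lim (trapezoid_gap f P u) v (tangent_gap f f1 u v / 2).
Proof.
  intros H1 HP v. unfold trapezoid_gap, tangent_gap.
  eapply dpl_ext with (f := fun x => P u + (- P x) + (- (/ 2 * ((u - x) * (f u + f x))))).
  - apply derivable_pt_lim_plus.
    + apply derivable_pt_lim_plus; [apply derivable_pt_lim_const|apply derivable_pt_lim_opp, HP].
    + apply derivable_pt_lim_opp, derivable_pt_lim_scal, (derivable_pt_lim_mult (fun x => u - x) (fun x => f u + f x)).
      * apply is_derive_Reals; auto_derive; [exact I|reflexivity].
      * apply derivable_pt_lim_plus; [apply derivable_pt_lim_const|apply H1].
  - intros; field.
  - field.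
Qed.

(** * Rescaling and comparison with the cubic *)

(** A force of order [h^3] balances [y y'] when [y] has order [h^2]; the friction [a y^(p+1)] then
    has order [h^(2p+2)], whence the relative exponent [2 p - 1]. *)
Lemma orbit_scale F a p u v y h : 0 < h -> orbit F a p u v y ->
  orbit (fun t => F (h * t) / h ^ 3) (a * Rpower h (2 * p - 1)) p (u / h) (v / h)
        (fun t => y (h * t) / h ^ 2).
Proof.
  intros Hh (Hvu & Hc & Hl & Hr & Hpos & Hd).
  assert (Hle : forall t c, c / h <= t -> c <= h * t).
  { intros t c H. apply Rmult_le_compat_l with (r := h) in H; [|lra].
    replace (h * (c / h)) with c in H by (field; lra). exact H. }
  assert (Hge : forall t c, t <= c / h -> h * t <= c).
  { intros t c H. apply Rmult_le_compat_l with (r := h) in H; [|lra].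
    replace (h * (c / h)) with c in H by (field; lra). exact H. }
  assert (Hin : forall t, v / h < t < u / h -> v < h * t < u).
  { intros t [A B]. split.
    - apply Rmult_lt_compat_l with (r := h) in A; [|lra].
      replace (h * (v / h)) with v in A by (field; lra). exact A.
    - apply Rmult_lt_compat_l with (r := h) in B; [|lra].
      replace (h * (u / h)) with u in B by (field; lra). exact B. }
  assert (H2 : 0 < h ^ 2) by (apply pow_lt; lra).
  split; [|split; [|split; [|split; [|split]]]].
  - apply Rmult_lt_compat_r; [apply Rinv_0_lt_compat|]; lra.
  - intros t. apply (continuity_pt_mult (fun t => y (h * t)) (fun _ => / h ^ 2));
      [|apply continuity_pt_const; intros ? ?; reflexivity].
    apply (continuity_pt_comp (fun t => h * t) y); [|apply Hc].
    apply dpl_continuity_pt with (h * 1), derivable_pt_lim_scal, derivable_pt_lim_id.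
  - intros t Ht. rewrite Hl; [field; lra|auto].
  - intros t Ht. rewrite Hr; [field; lra|auto].
  - intros t Ht. apply Rdiv_lt_0_compat; [apply Hpos; auto|exact H2].
  - intros t Ht. specialize (Hin t Ht). pose proof (Hpos _ Hin) as Hy.
    eapply dpl_ext with (f := fun t => / h ^ 2 * y (h * t)).
    + apply derivable_pt_lim_scal.
      apply (derivable_pt_lim_comp (fun t => h * t) y); [|apply Hd; exact Hin].
      apply derivable_pt_lim_scal, derivable_pt_lim_id.
    + intros; field; lra.
    + replace (Rpower (y (h * t)) p) with (Rpower (h ^ 2) p * Rpower (y (h * t) / h ^ 2) p).
      * replace (Rpower h (2 * p - 1)) with (Rpower (h ^ 2) p / h).
        -- field. repeat split; lra.
        -- unfold Rminus. rewrite Rpower_plus, Rpower_Ropp, Rpower_1 by lra.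
           rewrite <- (Rpower_pow 2 h Hh), Rpower_mult. reflexivity.
      * rewrite Rpower_mult_distr; [f_equal; field; lra|lra|apply Rdiv_lt_0_compat; lra].
Qed.

Lemma cc_f2_0 f f1 f2 f3 : concave_convex f f1 f2 f3 -> f2 0 = 0.
Proof.
  intros ((_ & _ & H3 & _) & Hs & _).
  assert (C : continuity_pt f2 0) by (eapply dpl_continuity_pt, H3).
  destruct (Rtotal_order (f2 0) 0) as [H|[H|H]]; [exfalso|exact H|exfalso].
  - destruct (continuity_pt_pos_local (fun t => - f2 t) 0 0) as (d & Hd & D);
      [apply continuity_pt_opp, C|lra|].
    specialize (D (d / 2) ltac:(apply Rabs_def1; lra)).
    specialize (Hs (d / 2) ltac:(lra)). nra.
  - destruct (continuity_pt_pos_local f2 0 0 C H) as (d & Hd & D).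
    specialize (D (- (d / 2)) ltac:(apply Rabs_def1; lra)).
    specialize (Hs (- (d / 2)) ltac:(lra)). nra.
Qed.

Lemma cc_f3_pos f f1 f2 f3 : concave_convex f f1 f2 f3 -> 0 < f3 0.
Proof.
  intros H. pose proof (cc_f2_0 _ _ _ _ H) as Z.
  destruct H as ((_ & _ & H3 & _) & Hs & Hne & _).
  destruct (Rtotal_order (f3 0) 0) as [H|[H|H]]; [exfalso|tauto|exact H].
  destruct (deriv_neg_local f2 0 (f3 0) (H3 0) H) as (d & Hd & D).
  specialize (D (d / 2) ltac:(lra)). rewrite Z, Rplus_0_l in D.
  specialize (Hs (d / 2) ltac:(lra)). nra.
Qed.

(** This is differentiability of [f2] at 0. The range of [s] gives [|t| <= 2 h]; the bound [-2] is a
    safe margin below the relevant ratios, which are close to [[-1, -1/2]]. *)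
Lemma cc_f2_near_0 f f1 f2 f3 (k : R) : concave_convex f f1 f2 f3 -> f3 0 = 6 * k ->
  forall eta, 0 < eta -> exists d, 0 < d /\
    forall h s, 0 < h < d -> -2 <= s < 0 ->
      forall t, h * s <= t <= h -> Rabs (f2 t - 6 * k * t) <= 2 * eta * h.
Proof.
  intros H Hk eta He. pose proof (cc_f2_0 _ _ _ _ H) as Z.
  destruct H as ((_ & _ & H3 & _) & _).
  destruct (H3 0 eta He) as [d Hd]. pose proof (cond_pos d).
  exists (d / 2). split; [lra|]. intros h s Hh Hs t Ht.
  assert (Ha : Rabs t <= 2 * h) by (apply Rabs_le; nra).
  destruct (Req_dec t 0) as [->|Ht0].
  - rewrite Z, Rmult_0_r, Rminus_0_r, Rabs_R0. nra.
  - specialize (Hd t Ht0 ltac:(lra)).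
    rewrite Rplus_0_l, Z, Hk in Hd.
    replace (f2 t - 6 * k * t) with (((f2 t - 0) / t - 6 * k) * t) by (field; exact Ht0).
    rewrite Rabs_mult. pose proof (Rabs_pos t). pose proof (Rabs_pos ((f2 t - 0) / t - 6 * k)). nra.
Qed.

Lemma tangent_gap_bound f f1 f2 K u v :
  (forall t, derivable_pt_lim f t (f1 t)) -> (forall t, derivable_pt_lim f1 t (f2 t)) ->
  v < u -> (forall t, v <= t <= u -> Rabs (f2 t) <= K) ->
  Rabs (tangent_gap f f1 u v) <= K * (u - v) ^ 2.
Proof.
  intros H1 H2 Hvu HK. unfold tangent_gap.
  destruct (mvt_open f f1 v u) as (c & Hc & E);
    [lra|auto|intros; eapply dpl_continuity_pt, H1|].
  destruct (mvt_open f1 f2 v c) as (c' & Hc' & E');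
    [lra|auto|intros; eapply dpl_continuity_pt, H2|].
  replace (f u - f v - (u - v) * f1 v) with (f2 c' * ((c - v) * (u - v))) by (rewrite E; nra).
  rewrite Rabs_mult, (Rabs_right ((c - v) * (u - v))) by nra.
  specialize (HK c' ltac:(lra)). pose proof (Rabs_pos (f2 c')).
  replace (K * (u - v) ^ 2) with (K * ((u - v) * (u - v))) by ring.
  apply Rmult_le_compat; try nra.
Qed.

(** All three quantities are linear in the pair [f], [P]. On [k t^3] they are the stated
    polynomials, and the remainder [r] has second derivative at most [K] in absolute value. The
    trapezoid bound follows from the tangent bound by the mean value theorem in [v]. *)
Lemma near_cubic_bounds f f1 f2 P (k K u v : R) :
  (forall t, derivable_pt_lim f t (f1 t)) -> (forall t, derivable_pt_lim f1 t (f2 t)) ->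
  (forall t, derivable_pt_lim P t (f t)) ->
  v < u -> (forall t, v <= t <= u -> Rabs (f2 t - 6 * k * t) <= K) ->
  (forall t, v <= t <= u ->
     Rabs (chordF f u v t - k * (t - u) * (t - v) * (t + u + v)) <= K / 2 * (t - v) * (u - t)) /\
  Rabs (tangent_gap f f1 u v - k * (u - v) ^ 2 * (u + 2 * v)) <= K * (u - v) ^ 2 /\
  Rabs (trapezoid_gap f P u v + k * (u - v) ^ 3 * (u + v) / 4) <= K / 2 * (u - v) ^ 3.
Proof.
  intros H1 H2 HP Hvu HK.
  set (r := fun t => f t - k * t ^ 3). set (r1 := fun t => f1 t - 3 * k * t ^ 2).
  set (r2 := fun t => f2 t - 6 * k * t). set (Pr := fun t => P t - k * t ^ 4 / 4).
  assert (D1 : forall t, derivable_pt_lim r t (r1 t)).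
  { intros t. eapply dpl_ext with (f := fun t => f t + - (k * t ^ 3)).
    - apply derivable_pt_lim_plus; [apply H1|apply is_derive_Reals; auto_derive; [exact I|reflexivity]].
    - intros; unfold r; ring.
    - unfold r1; ring. }
  assert (D2 : forall t, derivable_pt_lim r1 t (r2 t)).
  { intros t. eapply dpl_ext with (f := fun t => f1 t + - (3 * k * t ^ 2)).
    - apply derivable_pt_lim_plus; [apply H2|apply is_derive_Reals; auto_derive; [exact I|reflexivity]].
    - intros; unfold r1; ring.
    - unfold r2; ring. }
  assert (DP : forall t, derivable_pt_lim Pr t (r t)).
  { intros t. eapply dpl_ext with (f := fun t => P t + - (k * t ^ 4 / 4)).
    - apply derivable_pt_lim_plus; [apply HP|apply is_derive_Reals; auto_derive; [exact I|reflexivity]].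
    - intros; unfold Pr; ring.
    - unfold r; field. }
  assert (BD : forall c, v <= c < u -> Rabs (tangent_gap r r1 u c) <= K * (u - c) ^ 2).
  { intros c Hc. apply tangent_gap_bound with r2; auto; [lra|]. intros t Ht; apply HK; lra. }
  split; [|split].
  - intros t Ht.
    pose proof (chord_error r r1 r2 K v t u D1 D2 Ht ltac:(intros; apply HK; lra)) as C.
    replace (r t * (u - v) - (r v * (u - t) + r u * (t - v)))
      with ((chordF f u v t - k * (t - u) * (t - v) * (t + u + v)) * (u - v)) in C
      by (unfold r, chordF; field; lra).
    rewrite Rabs_mult, (Rabs_right (u - v)) in C by lra.
    apply Rmult_le_reg_r with (u - v); [lra|exact C].
  - replace (tangent_gap f f1 u v - k * (u - v) ^ 2 * (u + 2 * v)) with (tangent_gap r r1 u v)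
      by (unfold tangent_gap, r, r1; ring).
    apply BD; lra.
  - destruct (mvt_open (trapezoid_gap r Pr u) (fun c => tangent_gap r r1 u c / 2) v u) as (c & Hc & E).
    + exact Hvu.
    + intros x _. apply trapezoid_gap_deriv; assumption.
    + intros x _. eapply dpl_continuity_pt, trapezoid_gap_deriv; eassumption.
    + replace (trapezoid_gap r Pr u u) with 0 in E by (unfold trapezoid_gap; field).
      replace (trapezoid_gap f P u v + k * (u - v) ^ 3 * (u + v) / 4) with (trapezoid_gap r Pr u v)
        by (unfold trapezoid_gap, r, Pr; field).
      replace (trapezoid_gap r Pr u v) with (- (tangent_gap r r1 u c * ((u - v) / 2))) by lra.
      rewrite Rabs_Ropp, Rabs_mult, (Rabs_right ((u - v) / 2)) by lra.
      replace (K / 2 * (u - v) ^ 3) with (K * (u - v) ^ 2 * ((u - v) / 2)) by field.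
      apply Rmult_le_compat_r; [lra|].
      apply Rle_trans with (1 := BD c ltac:(lra)).
      assert (0 <= K) by (eapply Rle_trans; [apply Rabs_pos|apply (HK u); lra]).
      apply Rmult_le_compat_l; [assumption|]. apply pow_incr; lra.
Qed.

(** In its last argument [t] the gap has derivative [- (u - t) f2 t]: it increases for [t < 0],
    decreases on [(0, u)] to its zero at [u], and increases again. So its only other zero is
    negative. *)
Lemma tangent_gap_sign f f1 f2 f3 phin u : concave_convex f f1 f2 f3 -> is_tangent f f1 phin ->
  0 < u ->
  phin u < 0 /\ tangent_gap f f1 u (phin u) = 0 /\
  (forall t, t < phin u -> tangent_gap f f1 u t < 0) /\
  (forall t, phin u < t < 0 -> 0 < tangent_gap f f1 u t).
Proof.
  intros ((H1 & H2 & _ & _) & Hs & _) [_ Ht] Hu.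
  destruct (Ht u ltac:(lra)) as [Hne E].
  assert (Z : tangent_gap f f1 u (phin u) = 0).
  { unfold tangent_gap. rewrite E. field. lra. }
  pose proof (tangent_gap_deriv f f1 f2 u H1 H2) as D.
  assert (Zu : tangent_gap f f1 u u = 0) by (unfold tangent_gap; ring).
  assert (M : forall a b, a < b -> exists c, a < c < b /\
     tangent_gap f f1 u b - tangent_gap f f1 u a = - (u - c) * f2 c * (b - a)).
  { intros a b Hab. apply (mvt_open (tangent_gap f f1 u) (fun c => - (u - c) * f2 c));
      [exact Hab|auto|intros; eapply dpl_continuity_pt, D]. }
  assert (Hn : forall c, c < 0 -> f2 c < 0) by (intros c Hc; specialize (Hs c ltac:(lra)); nra).
  assert (Hp : forall c, 0 < c -> 0 < f2 c) by (intros c Hc; specialize (Hs c ltac:(lra)); nra).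
  assert (Incr : forall a b, a < b <= 0 -> tangent_gap f f1 u a < tangent_gap f f1 u b).
  { intros a b Hab. destruct (M a b ltac:(lra)) as (c & Hc & Ec). specialize (Hn c ltac:(lra)).
    pose proof (Rmult_lt_0_compat (u - c) (- f2 c) ltac:(lra) ltac:(lra)).
    pose proof (Rmult_lt_0_compat ((u - c) * - f2 c) (b - a) ltac:(lra) ltac:(lra)). nra. }
  assert (Hneg : phin u < 0).
  { apply Rnot_le_lt; intros H0. destruct (Rtotal_order (phin u) u) as [H|[H|H]]; [|tauto|].
    - destruct (M (phin u) u H) as (c & Hc & Ec). specialize (Hp c ltac:(lra)).
      pose proof (Rmult_lt_0_compat (u - c) (f2 c) ltac:(lra) ltac:(lra)).
      pose proof (Rmult_lt_0_compat ((u - c) * f2 c) (u - phin u) ltac:(lra) ltac:(lra)). nra.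
    - destruct (M u (phin u) H) as (c & Hc & Ec). specialize (Hp c ltac:(lra)).
      pose proof (Rmult_lt_0_compat (c - u) (f2 c) ltac:(lra) ltac:(lra)).
      pose proof (Rmult_lt_0_compat ((c - u) * f2 c) (phin u - u) ltac:(lra) ltac:(lra)). nra. }
  split; [exact Hneg|]. split; [exact Z|]. split.
  - intros t Htt. rewrite <- Z. apply Incr; lra.
  - intros t Htt. rewrite <- Z. apply Incr; lra.
Qed.

(** For the cubic the gap is [k h^3 (1 - s)^2 (1 + 2 s)]. At [s = -1/2 - e] and [s = -1/2 + e] its
    size is twice the allowed error, so the signs of the true gap there enclose [phin h]. *)
Lemma phin_ratio f f1 f2 f3 phin : concave_convex f f1 f2 f3 -> is_tangent f f1 phin ->
  forall eps, 0 < eps -> exists d, 0 < d /\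
    forall h, 0 < h < d -> Rabs (phin h / h - -1/2) < eps.
Proof.
  intros H Ht eps He. set (k := f3 0 / 6).
  assert (Hk : 0 < k) by (pose proof (cc_f3_pos _ _ _ _ H); unfold k; lra).
  set (e := Rmin eps (1/4)).
  assert (Hee : 0 < e /\ e <= eps /\ e <= 1/4)
    by (unfold e; repeat split; [apply Rmin_pos; lra|apply Rmin_l|apply Rmin_r]).
  destruct (cc_f2_near_0 f f1 f2 f3 k H ltac:(unfold k; field) (k * e / 2)) as (d & Hd & D).
  { apply Rdiv_lt_0_compat; [apply Rmult_lt_0_compat; lra|lra]. }
  exists d; split; [exact Hd|]. intros h Hh.
  destruct (tangent_gap_sign _ _ _ _ _ h H Ht ltac:(lra)) as (Hneg & Z & Sl & Sr).
  pose proof H as ((H1 & H2 & H3 & _) & _).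
  destruct (primitive_exists f) as [P HP]; [intros x; eapply dpl_continuity_pt, H1|].
  assert (T : forall s, -2 <= s < 0 ->
     Rabs (tangent_gap f f1 h (h * s) - k * (h ^ 3 * (1 - s) ^ 2) * (1 + 2 * s))
       <= k * e * (h ^ 3 * (1 - s) ^ 2) /\ 0 < h ^ 3 * (1 - s) ^ 2).
  { intros s Hs.
    destruct (near_cubic_bounds f f1 f2 P k (2 * (k * e / 2) * h) h (h * s) H1 H2 HP) as (_ & B & _).
    - nra.
    - intros t Htt. apply (D h s Hh Hs t Htt).
    - split.
      + replace (k * (h ^ 3 * (1 - s) ^ 2) * (1 + 2 * s))
          with (k * (h - h * s) ^ 2 * (h + 2 * (h * s))) by ring.
        replace (k * e * (h ^ 3 * (1 - s) ^ 2)) with (2 * (k * e / 2) * h * (h - h * s) ^ 2) by field.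
        exact B.
      + apply Rmult_lt_0_compat; apply pow_lt; lra. }
  assert (Hke : 0 < k * e) by (apply Rmult_lt_0_compat; lra).
  assert (A1 : h * (-1/2 - e) < phin h).
  { destruct (T (-1/2 - e) ltac:(lra)) as [B Q].
    set (q := h ^ 3 * (1 - (-1/2 - e)) ^ 2) in *.
    apply Rnot_le_lt; intros Hc.
    assert (0 <= tangent_gap f f1 h (h * (-1/2 - e))).
    { destruct Hc as [Hc|Hc]; [apply Rlt_le, Sr; split; [exact Hc|nra]|rewrite <- Hc; lra]. }
    apply Rabs_le_between in B.
    replace (k * q * (1 + 2 * (-1/2 - e))) with (- (2 * (k * e * q))) in B by field.
    pose proof (Rmult_lt_0_compat _ _ Hke Q). lra. }
  assert (A2 : phin h < h * (-1/2 + e)).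
  { destruct (T (-1/2 + e) ltac:(lra)) as [B Q].
    set (q := h ^ 3 * (1 - (-1/2 + e)) ^ 2) in *.
    apply Rnot_le_lt; intros Hc.
    assert (tangent_gap f f1 h (h * (-1/2 + e)) <= 0).
    { destruct Hc as [Hc|Hc]; [apply Rlt_le, Sl; exact Hc|rewrite Hc; lra]. }
    apply Rabs_le_between in B.
    replace (k * q * (1 + 2 * (-1/2 + e))) with ((2 * (k * e * q))) in B by field.
    pose proof (Rmult_lt_0_compat _ _ Hke Q). lra. }
  apply Rabs_def1.
  - apply Rmult_lt_reg_r with h; [lra|].
    replace ((phin h / h - -1/2) * h) with (phin h + h / 2) by (field; lra). nra.
  - apply Rmult_lt_reg_r with h; [lra|].
    replace ((phin h / h - -1/2) * h) with (phin h + h / 2) by (field; lra). nra.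
Qed.

(** A priori bound on the end of a wave. For the cubic the gap is a positive multiple of
    [- (1 + s)], so it is positive at [s = -1 - e]; beyond the tangency point it grows as [v]
    decreases, so no lower [v] satisfies the energy inequality. *)
Lemma trapezoid_lower_bound f f1 f2 f3 phin P : concave_convex f f1 f2 f3 -> is_tangent f f1 phin ->
  (forall t, derivable_pt_lim P t (f t)) ->
  forall eps, 0 < eps -> exists d, 0 < d /\
    forall h v, 0 < h < d -> v <= phin h -> trapezoid_gap f P h v <= 0 -> -1 - eps <= v / h.
Proof.
  intros H Ht HP eps He. set (k := f3 0 / 6).
  assert (Hk : 0 < k) by (pose proof (cc_f3_pos _ _ _ _ H); unfold k; lra).
  set (e := Rmin eps (1/4)).
  assert (Hee : 0 < e /\ e <= eps /\ e <= 1/4)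
    by (unfold e; repeat split; [apply Rmin_pos; lra|apply Rmin_l|apply Rmin_r]).
  assert (Hke : 0 < k * e) by (apply Rmult_lt_0_compat; lra).
  destruct (cc_f2_near_0 f f1 f2 f3 k H ltac:(unfold k; field) (k * e / 8) ltac:(lra)) as (d & Hd & D).
  destruct (phin_ratio _ _ _ _ _ H Ht (1/4) ltac:(lra)) as (d' & Hd' & D').
  exists (Rmin d d'); split; [apply Rmin_pos; assumption|]. intros h v Hh Hv HT.
  assert (Hh1 : 0 < h < d) by (pose proof (Rmin_l d d'); lra).
  assert (Hh2 : 0 < h < d') by (pose proof (Rmin_r d d'); lra).
  specialize (D' h Hh2). apply Rabs_def2 in D'.
  assert (Hph : - (3/4) * h < phin h).
  { replace (phin h) with (phin h / h * h) by (field; lra). apply Rmult_lt_compat_r; lra. }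
  destruct (tangent_gap_sign _ _ _ _ _ h H Ht ltac:(lra)) as (Hneg & Z & Sl & Sr).
  pose proof H as ((H1 & H2 & H3 & _) & _).
  set (s := -1 - e).
  destruct (near_cubic_bounds f f1 f2 P k (2 * (k * e / 8) * h) h (h * s) H1 H2 HP) as (_ & _ & B).
  { unfold s; nra. }
  { intros t Htt. apply (D h s Hh1 ltac:(unfold s; lra) t Htt). }
  assert (Q : 0 < h ^ 4 * (1 - s) ^ 3).
  { apply Rmult_lt_0_compat; apply pow_lt; unfold s; lra. }
  set (q := h ^ 4 * (1 - s) ^ 3) in *.
  replace (k * (h - h * s) ^ 3 * (h + h * s) / 4) with (- (k * e * q / 4)) in B
    by (unfold q, s; field).
  replace (2 * (k * e / 8) * h / 2 * (h - h * s) ^ 3) with (k * e * q / 8) in B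
    by (unfold q, s; field).
  apply Rabs_le_between in B. pose proof (Rmult_lt_0_compat _ _ Hke Q).
  assert (Hpos : 0 < trapezoid_gap f P h (h * s)) by lra.
  apply Rnot_lt_le; intros Hc.
  assert (Hvs : v < h * s).
  { replace v with (h * (v / h)) by (field; lra). apply Rmult_lt_compat_l; [lra|]. unfold s; lra. }
  assert (Hsp : h * s < phin h) by (unfold s; nra).
  assert (- trapezoid_gap f P h v < - trapezoid_gap f P h (h * s)); [|lra].
  apply (increasing_of_deriv (fun x => - trapezoid_gap f P h x) (fun x => - (tangent_gap f f1 h x / 2)));
    [exact Hvs| | |].
  - intros x _; apply derivable_pt_lim_opp, trapezoid_gap_deriv; assumption.
  - intros x _; eapply dpl_continuity_pt, derivable_pt_lim_opp, trapezoid_gap_deriv; eassumption.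
  - intros x Hx. specialize (Sl x ltac:(lra)). lra.
Qed.

(** * Rescaled waves *)

Definition cubic (k s t : R) : R := k * (t - 1) * (t - s) * (t + 1 + s).

(** The error shares the factors [1 - t] and [t - s] with the cubic. It can thus be absorbed into
    the remaining factor [t + 1 + s] up to both ends, where barriers that vanish with the orbit
    leave no room. *)
Definition near_cubic (k eta s : R) (F : R -> R) : Prop :=
  forall t, s <= t <= 1 -> Rabs (F t - cubic k s t) <= eta * ((1 - t) * (t - s)).

(* [s] and [s0] are the ratios to [u] of the wave's endpoint and of the tangency point of [u]. *)
Definition scaled_wave (k eta a p s s0 : R) : Prop :=
  -1 - eta <= s <= -1/2 + eta /\ Rabs (s0 - -1/2) <= eta /\
  exists F y, orbit F a p 1 s y /\ near_cubic k eta s F /\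
    (s <> s0 -> exists xi, 0 < xi /\ forall t, s < t < s + xi -> 0 <= F t) /\
    (s = s0 -> forall t, s < t < 1 -> F t <= 0).

(** The lower bound on the ratio comes from the energy inequality, the upper one from lying beyond
    the tangency point. The sign clauses come from the slope of [F] at the end: positive strictly
    beyond tangency, zero at tangency, where [F] is then negative up to the other end. *)
Lemma scaled_wave_right f f1 f2 f3 phin : concave_convex f f1 f2 f3 -> is_tangent f f1 phin ->
  forall eta, 0 < eta -> exists d, 0 < d /\
    forall h alpha p v, 0 < h < d -> 0 < alpha -> beyond phin h v -> reachable f alpha p h v ->
      scaled_wave (f3 0 / 6) eta (alpha * Rpower h (2 * p - 1)) p (v / h) (phin h / h).
Proof.
  intros H Ht eta He. set (k := f3 0 / 6).
  pose proof H as ((H1 & H2 & H3 & _) & Hs & _).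
  destruct (primitive_exists f) as [P HP]; [intros x; eapply dpl_continuity_pt, H1|].
  destruct (phin_ratio _ _ _ _ _ H Ht eta He) as (d1 & Hd1 & D1).
  destruct (trapezoid_lower_bound _ _ _ _ _ P H Ht HP (Rmin eta 1)) as (d2 & Hd2 & D2).
  { apply Rmin_pos; lra. }
  destruct (cc_f2_near_0 f f1 f2 f3 k H ltac:(unfold k; field) eta He) as (d3 & Hd3 & D3).
  exists (Rmin d1 (Rmin d2 d3)). split; [repeat apply Rmin_pos; assumption|].
  intros h alpha p v Hh Ha [Hb1 Hb2] [Hne [w (w1 & w2 & W1 & W2 & _ & Wm & Wp & Wm1 & Wp1 & Wo)]].
  pose proof (Rmin_l d1 (Rmin d2 d3)). pose proof (Rmin_r d1 (Rmin d2 d3)).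
  pose proof (Rmin_l d2 d3). pose proof (Rmin_r d2 d3).
  assert (Hv : v <= phin h) by (destruct Hb2 as [[_ ?]|[? _]]; lra).
  destruct (tangent_gap_sign _ _ _ _ _ h H Ht ltac:(lra)) as (Hneg & Z & Sl & Sr).
  set (F := chordF f h v). set (G := chordG f P h v).
  assert (W : wave F G alpha p h v w w1 w2).
  { constructor; auto; [lra|apply chordG_deriv; exact HP|apply chordG_right]. }
  (* The sign is read off the wave itself: its final energy [- G v] cannot exceed its initial energy
     0. *)
  assert (HGv : 0 <= G v) by (pose proof (wave_energy_bounds W 0); lra).
  assert (HTv : trapezoid_gap f P h v <= 0).
  { unfold G in HGv. rewrite chordG_left in HGv by lra. lra. }
  pose proof (D2 h v ltac:(lra) Hv HTv) as Hlow.
  specialize (D1 h ltac:(lra)).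
  set (F1 := fun t => f1 t - (f v - f h) / (v - h)).
  assert (HF1 : F1 v = - tangent_gap f f1 h v / (h - v)).
  { unfold F1, tangent_gap. field. lra. }
  assert (DF : forall t, derivable_pt_lim F t (F1 t)) by (apply chordF_deriv, H1).
  assert (DF1 : forall t, derivable_pt_lim F1 t (f2 t)).
  { intros t. eapply dpl_ext with (f := fun t => f1 t - (f v - f h) / (v - h)); [|reflexivity|].
    - apply derivable_pt_lim_minus; [apply H2|apply derivable_pt_lim_const].
    - ring. }
  assert (Hgap : tangent_gap f f1 h v <= 0).
  { destruct Hv as [Hv| ->]; [specialize (Sl v Hv)|]; lra. }
  assert (HF1v : 0 <= F1 v).
  { rewrite HF1. apply Rmult_le_pos; [lra|]. apply Rlt_le, Rinv_0_lt_compat; lra. }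
  assert (Hn : forall t, t < 0 -> f2 t < 0) by (intros c Hc; specialize (Hs c ltac:(lra)); nra).
  assert (Hp : forall t, 0 < t -> 0 < f2 t) by (intros c Hc; specialize (Hs c ltac:(lra)); nra).
  assert (Fv : F v = 0) by (apply chordF_left; lra).
  assert (Fh : F h = 0) by (apply chordF_right).
  assert (S : wave_signs F G h v).
  { apply (cc_wave_signs F F1 f2 G); auto; [lra|apply chordG_deriv; exact HP|apply chordG_right]. }
  destruct (wave_orbit W S) as [y Hy].
  apply (orbit_scale F alpha p h v y h ltac:(lra)) in Hy.
  replace (h / h) with 1 in Hy by (field; lra).
  assert (Hh0 : 0 < h) by lra.
  assert (Hin : forall t, v / h < t -> v < h * t).
  { intros t A. apply Rmult_lt_compat_l with (r := h) in A; [|lra].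
    replace (h * (v / h)) with v in A by (field; lra). exact A. }
  assert (Hh3 : 0 < / h ^ 3) by (apply Rinv_0_lt_compat, pow_lt; lra).
  split; [|split].
  - split.
    + pose proof (Rmin_l eta 1); lra.
    + assert (v / h <= phin h / h).
      { apply Rmult_le_compat_r; [apply Rlt_le, Rinv_0_lt_compat; lra|exact Hv]. }
      apply Rabs_def2 in D1. lra.
  - lra.
  - exists (fun t => F (h * t) / h ^ 3), (fun t => y (h * t) / h ^ 2).
    split; [exact Hy|]. split; [|split].
    + intros t Htt.
      assert (Hs2 : -2 <= v / h) by (pose proof (Rmin_r eta 1); lra).
      assert (Hs0 : v / h < 0).
      { apply Rmult_lt_reg_r with h; [lra|]. replace (v / h * h) with v by (field; lra). lra. }
      destruct (near_cubic_bounds f f1 f2 P k (2 * eta * h) h v H1 H2 HP ltac:(lra)) as (B & _).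
      { intros x Hx. apply (D3 h (v / h)); [lra|lra|].
        replace (h * (v / h)) with v by (field; lra). exact Hx. }
      assert (Hx : v <= h * t <= h).
      { split; [|nra]. destruct (proj1 Htt) as [A|A]; [apply Rlt_le, Hin, A|].
        rewrite <- A. right. field. lra. }
      specialize (B (h * t) Hx).
      apply Rmult_le_compat_r with (r := / h ^ 3) in B; [|lra].
      rewrite <- (Rabs_right (/ h ^ 3)) in B at 1 by lra.
      rewrite <- Rabs_mult in B.
      replace (F (h * t) / h ^ 3 - cubic k (v / h) t)
        with ((chordF f h v (h * t) - k * (h * t - h) * (h * t - v) * (h * t + h + v)) * / h ^ 3)
        by (unfold F, cubic; field; lra).
      replace (eta * ((1 - t) * (t - v / h)))
        with (2 * eta * h / 2 * (h * t - v) * (h - h * t) * / h ^ 3) by (field; lra).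
      exact B.
    + intros Hne'.
      assert (Hlt : v < phin h).
      { destruct Hv as [|E]; [assumption|]. exfalso; apply Hne'; rewrite E; reflexivity. }
      specialize (Sl v Hlt).
      assert (HF1p : 0 < F1 v) by (rewrite HF1; apply Rdiv_lt_0_compat; lra).
      destruct (deriv_pos_local F v (F1 v) (DF v) HF1p) as (d & Hd & D).
      exists (d / h). split; [apply Rdiv_lt_0_compat; lra|]. intros t Htt.
      assert (Hx : 0 < h * t - v < d).
      { split; [specialize (Hin t (proj1 Htt)); lra|].
        destruct Htt as [_ A]. apply Rmult_lt_compat_l with (r := h) in A; [|lra].
        replace (h * (v / h + d / h)) with (v + d) in A by (field; lra). lra. }
      specialize (D _ Hx). replace (v + (h * t - v)) with (h * t) in D by ring.
      apply Rmult_le_pos; lra.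
    + intros Heq t Htt.
      assert (Ev : v = phin h).
      { replace v with (h * (v / h)) by (field; lra). rewrite Heq. field. lra. }
      assert (F (h * t) < 0).
      { apply (cc_tangent_neg F F1 f2 h v); auto; [lra| |].
        - rewrite HF1, Ev, Z. field. lra.
        - split; [apply Hin; lra|nra]. }
      pose proof (Rmult_lt_0_compat (- F (h * t)) _ ltac:(lra) Hh3). unfold Rdiv; lra.
Qed.

(** * Reflection *)

Lemma dpl_reflect (g : R -> R) (l x : R) :
  derivable_pt_lim g (- x) l -> derivable_pt_lim (fun t => - g (- t)) x l.
Proof.
  intros H. eapply dpl_ext with (f := fun t => - g (- t)); [|reflexivity|].
  - apply derivable_pt_lim_opp, (derivable_pt_lim_comp (fun t => - t) g); [|exact H].
    apply derivable_pt_lim_opp, derivable_pt_lim_id.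
  - ring.
Qed.

Lemma dpl_reflect_even (g : R -> R) (l x : R) :
  derivable_pt_lim g (- x) l -> derivable_pt_lim (fun t => g (- t)) x (- l).
Proof.
  intros H. eapply dpl_ext with (f := fun t => g (- t)); [|reflexivity|].
  - apply (derivable_pt_lim_comp (fun t => - t) g); [|exact H].
    apply derivable_pt_lim_opp, derivable_pt_lim_id.
  - ring.
Qed.

(** Reflecting both the flux and the wave preserves the equation, as the friction is odd, and fixes
    the third derivative at 0. Negative states are thereby reduced to positive ones. *)
Lemma concave_convex_reflect f f1 f2 f3 : concave_convex f f1 f2 f3 ->
  concave_convex (fun t => - f (- t)) (fun t => f1 (- t)) (fun t => - f2 (- t)) (fun t => f3 (- t)).
Proof.
  intros ((H1 & H2 & H3 & Hc) & Hs & Hne & Hp & Hm). split; [|split; [|split; [|split]]].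
  - split; [|split; [|split]].
    + intros x. apply dpl_reflect, H1.
    + intros x. apply dpl_reflect_even, H2.
    + intros x. apply dpl_reflect, H3.
    + intros x. apply (continuity_pt_comp (fun t => - t) f3); [|apply Hc].
      apply continuity_pt_opp, derivable_continuous_pt, derivable_pt_id.
  - intros u Hu. specialize (Hs (- u) ltac:(lra)). lra.
  - rewrite Ropp_0; exact Hne.
  - intros M. destruct (Hm M) as [N HN]. exists (- N). intros u Hu. apply HN; lra.
  - intros M. destruct (Hp M) as [N HN]. exists (- N). intros u Hu. apply HN; lra.
Qed.

Lemma is_tangent_reflect f f1 phin : is_tangent f f1 phin ->
  is_tangent (fun t => - f (- t)) (fun t => f1 (- t)) (fun t => - phin (- t)).
Proof.
  intros [H0 H]. split; [rewrite Ropp_0, H0; ring|].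
  intros u Hu. destruct (H (- u) ltac:(lra)) as [Hne E]. split; [lra|].
  rewrite !Ropp_involutive, E. field. lra.
Qed.

Lemma beyond_reflect phin u v : beyond phin u v ->
  beyond (fun t => - phin (- t)) (- u) (- v).
Proof.
  intros [H1 H2]. split; [lra|]. rewrite !Ropp_involutive.
  destruct H2 as [[? ?]|[? ?]]; [right|left]; lra.
Qed.

Lemma spow_opp v p : spow (- v) p = - spow v p.
Proof.
  unfold spow. destruct (Req_EM_T (- v) 0); destruct (Req_EM_T v 0); try lra.
  rewrite Rabs_Ropp. ring.
Qed.

Lemma reachable_reflect f alpha p u v : reachable f alpha p u v ->
  reachable (fun t => - f (- t)) alpha p (- u) (- v).
Proof.
  intros [Hne [w (w1 & w2 & W1 & W2 & Wc & Wm & Wp & Wm1 & Wp1 & Wo)]].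
  split; [lra|]. exists (fun x => - w x), (fun x => - w1 x), (fun x => - w2 x).
  repeat split.
  - intros x; apply derivable_pt_lim_opp, W1.
  - intros x; apply derivable_pt_lim_opp, W2.
  - intros x; apply continuity_pt_opp, Wc.
  - intros eps He. destruct (Wm eps He) as [N HN]. exists N. intros x Hx.
    replace (- w x - - u) with (- (w x - u)) by ring. rewrite Rabs_Ropp. auto.
  - intros eps He. destruct (Wp eps He) as [N HN]. exists N. intros x Hx.
    replace (- w x - - v) with (- (w x - v)) by ring. rewrite Rabs_Ropp. auto.
  - intros eps He. destruct (Wm1 eps He) as [N HN]. exists N. intros x Hx.
    replace (- w1 x - 0) with (- (w1 x - 0)) by ring. rewrite Rabs_Ropp. auto.
  - intros eps He. destruct (Wp1 eps He) as [N HN]. exists N. intros x Hx.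
    replace (- w1 x - 0) with (- (w1 x - 0)) by ring. rewrite Rabs_Ropp. auto.
  - intros x. rewrite spow_opp, !Ropp_involutive.
    replace ((- f v - - f u) / (- v - - u)) with ((f v - f u) / (v - u)) by (field; lra).
    specialize (Wo x). lra.
Qed.

Lemma scaled_wave_exists f f1 f2 f3 phin : concave_convex f f1 f2 f3 -> is_tangent f f1 phin ->
  forall eta, 0 < eta -> exists d, 0 < d /\
    forall h alpha p v, 0 < Rabs h < d -> 0 < alpha -> beyond phin h v -> reachable f alpha p h v ->
      scaled_wave (f3 0 / 6) eta (alpha * Rpower (Rabs h) (2 * p - 1)) p (v / h) (phin h / h).
Proof.
  intros H Ht eta He.
  destruct (scaled_wave_right _ _ _ _ _ H Ht eta He) as (d1 & Hd1 & D1).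
  destruct (scaled_wave_right _ _ _ _ _ (concave_convex_reflect _ _ _ _ H)
              (is_tangent_reflect _ _ _ Ht) eta He) as (d2 & Hd2 & D2).
  exists (Rmin d1 d2). split; [apply Rmin_pos; assumption|].
  intros h alpha p v [Hh0 Hh] Ha Hb Hr.
  pose proof (Rmin_l d1 d2). pose proof (Rmin_r d1 d2).
  destruct (Rtotal_order h 0) as [Hn|[Hn|Hn]].
  - rewrite Rabs_left in * by exact Hn.
    specialize (D2 (- h) alpha p (- v) ltac:(lra) Ha (beyond_reflect _ _ _ Hb) (reachable_reflect _ _ _ _ _ Hr)).
    simpl in D2. rewrite Ropp_0, Ropp_involutive in D2.
    replace (- v / - h) with (v / h) in D2 by (field; lra).
    replace (- phin h / - h) with (phin h / h) in D2 by (field; lra). exact D2.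
  - subst; rewrite Rabs_R0 in Hh0; lra.
  - rewrite Rabs_right in * by lra. apply D1; auto; lra.
Qed.

Lemma phin_deriv f f1 f2 f3 phin : concave_convex f f1 f2 f3 -> is_tangent f f1 phin ->
  forall eps, 0 < eps -> exists d, 0 < d /\
    forall h, 0 < Rabs h < d -> Rabs (phin h / h - -1/2) < eps.
Proof.
  intros H Ht eps He.
  destruct (phin_ratio _ _ _ _ _ H Ht eps He) as (d1 & Hd1 & D1).
  destruct (phin_ratio _ _ _ _ _ (concave_convex_reflect _ _ _ _ H)
              (is_tangent_reflect _ _ _ Ht) eps He) as (d2 & Hd2 & D2).
  exists (Rmin d1 d2). split; [apply Rmin_pos; assumption|].
  intros h [Hh0 Hh]. pose proof (Rmin_l d1 d2). pose proof (Rmin_r d1 d2).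
  destruct (Rtotal_order h 0) as [Hn|[Hn|Hn]].
  - rewrite Rabs_left in Hh by exact Hn.
    specialize (D2 (- h) ltac:(lra)). simpl in D2. rewrite Ropp_involutive in D2.
    replace (- phin h / - h) with (phin h / h) in D2 by (field; lra). exact D2.
  - subst; rewrite Rabs_R0 in Hh0; lra.
  - rewrite Rabs_right in Hh by lra. apply D1; lra.
Qed.

(** * Barriers and energy balance for orbits *)

Lemma orbit_energy_deriv {F a p u v y} (O : orbit F a p u v y) t : v < t < u ->
  derivable_pt_lim (fun t => y t ^ 2 / 2) t (F t + a * (Rpower (y t) p * y t)).
Proof.
  intros Ht. destruct O as (_ & _ & _ & _ & Hp & Hd).
  specialize (Hp t Ht). specialize (Hd t Ht).
  eapply dpl_ext with (f := fun t => / 2 * (y t * y t)).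
  - apply derivable_pt_lim_scal, derivable_pt_lim_mult; exact Hd.
  - intros; field.
  - field. lra.
Qed.

Lemma half_square_continuity (y : R -> R) x :
  continuity_pt y x -> continuity_pt (fun t => y t ^ 2 / 2) x.
Proof.
  intros H. apply (continuity_pt_comp y (fun z => z ^ 2 / 2)); [exact H|].
  eapply dpl_continuity_pt. apply is_derive_Reals. auto_derive; [exact I|reflexivity].
Qed.

Lemma Rpower_pos x p : 0 < Rpower x p.
Proof. apply exp_pos. Qed.

Lemma Rpower_mul_le x z p : 0 <= p -> 0 < x <= z -> Rpower x p * x <= Rpower z p * z.
Proof.
  intros Hp Hx. apply Rmult_le_compat; try lra.
  - apply Rlt_le, Rpower_pos.
  - apply Rle_Rpower_l; lra.
Qed.

(* No Lipschitz estimate at the saddle [t = u] is needed: the friction term is monotone, so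
   [y^2 - b^2], once positive, stays positive up to [t = u], where [y] vanishes. *)
Lemma upper_barrier {F a p u v y} (O : orbit F a p u v y) (b db : R -> R) t0 :
  0 <= a -> 0 <= p -> v <= t0 < u ->
  (forall t, t0 < t < u -> derivable_pt_lim b t (db t)) ->
  (forall t, t0 <= t <= u -> continuity_pt b t) ->
  (forall t, t0 < t < u -> 0 < b t) -> 0 <= b t0 ->
  (forall t, t0 < t < u -> b t * db t <= F t + a * (Rpower (b t) p * b t)) ->
  y t0 <= b t0.
Proof.
  intros Ha Hp Ht0 Db Cb Pb Pb0 Hb. pose proof O as (_ & Cy & Yl & Yr & Py & _).
  apply Rnot_lt_le; intros H.
  assert (0 < y u ^ 2 / 2 - b u ^ 2 / 2).
  { apply (pos_persists (fun t => y t ^ 2 / 2 - b t ^ 2 / 2)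
       (fun t => F t + a * (Rpower (y t) p * y t) - b t * db t) t0 u).
    - lra.
    - intros t Ht. apply derivable_pt_lim_minus; [apply (orbit_energy_deriv O); lra|].
      eapply dpl_ext with (f := fun t => / 2 * (b t * b t)).
      + apply derivable_pt_lim_scal, derivable_pt_lim_mult; apply Db, Ht.
      + intros; field.
      + field.
    - intros t Ht. apply continuity_pt_minus; apply half_square_continuity; [apply Cy|apply Cb, Ht].
    - intros t Ht Hpos. specialize (Hb t Ht). specialize (Pb t Ht). pose proof (Py t ltac:(lra)).
      assert (b t <= y t) by nra.
      pose proof (Rpower_mul_le (b t) (y t) p Hp ltac:(lra)). nra.
    - nra. }
  rewrite (Yr u) in H0 by lra. nra.
Qed.

(** The roles of [b] and [y] are exchanged; the contradiction at [u] now rests on [b u = 0]. *)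
Lemma lower_barrier {F a p u v y} (O : orbit F a p u v y) (b db : R -> R) t0 :
  0 <= a -> 0 <= p -> v < t0 < u ->
  (forall t, t0 < t < u -> derivable_pt_lim b t (db t)) ->
  (forall t, t0 <= t <= u -> continuity_pt b t) ->
  (forall t, t0 < t < u -> 0 < b t) -> b u = 0 ->
  (forall t, t0 < t < u -> F t + a * (Rpower (b t) p * b t) <= b t * db t) ->
  b t0 <= y t0.
Proof.
  intros Ha Hp Ht0 Db Cb Pb Pb0 Hb. pose proof O as (_ & Cy & Yl & Yr & Py & _).
  apply Rnot_lt_le; intros H.
  assert (0 < b u ^ 2 / 2 - y u ^ 2 / 2).
  { apply (pos_persists (fun t => b t ^ 2 / 2 - y t ^ 2 / 2)
       (fun t => b t * db t - (F t + a * (Rpower (y t) p * y t))) t0 u).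
    - lra.
    - intros t Ht. apply derivable_pt_lim_minus; [|apply (orbit_energy_deriv O); lra].
      eapply dpl_ext with (f := fun t => / 2 * (b t * b t)).
      + apply derivable_pt_lim_scal, derivable_pt_lim_mult; apply Db, Ht.
      + intros; field.
      + field.
    - intros t Ht. apply continuity_pt_minus; apply half_square_continuity; [apply Cb, Ht|apply Cy].
    - intros t Ht Hpos. specialize (Hb t Ht). specialize (Pb t Ht). pose proof (Py t ltac:(lra)).
      assert (y t <= b t) by nra.
      pose proof (Rpower_mul_le (y t) (b t) p Hp ltac:(lra)). nra.
    - pose proof (Py t0 Ht0). nra. }
  rewrite Pb0, (Yr u) in H0 by lra. lra.
Qed.

(** The orbit [y2], starting from 0 at [v2], is an upper barrier for the orbit of the larger force,
    which would then vanish at a point interior to its own interval. *)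
Lemma orbit_unique_end F1 F2 a p u v1 v2 y1 y2 :
  0 <= a -> 0 <= p -> orbit F1 a p u v1 y1 -> orbit F2 a p u v2 y2 ->
  v1 < v2 -> (forall t, v2 < t < u -> F2 t <= F1 t) -> False.
Proof.
  intros Ha Hp O1 O2 Hv HF. pose proof O2 as (Hv2 & Cy & Yl & Yr & Py & Dy).
  pose proof O1 as (_ & _ & _ & _ & Py1 & _).
  pose proof (upper_barrier O1 y2 (fun t => F2 t / y2 t + a * Rpower (y2 t) p) v2
                Ha Hp ltac:(lra) Dy ltac:(intros; apply Cy) Py) as B.
  rewrite (Yl v2) in B by lra. specialize (Py1 v2 ltac:(lra)).
  assert (y1 v2 <= 0); [|lra]. apply B; [lra|].
  intros t Ht. specialize (Py t Ht). specialize (HF t Ht).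
  replace (y2 t * (F2 t / y2 t + a * Rpower (y2 t) p)) with (F2 t + a * (Rpower (y2 t) p * y2 t))
    by (field; lra). lra.
Qed.

(** * Energy balance against the cubic *)

Definition cubicQ (k s t : R) : R :=
  k * (t ^ 4 / 4 - (1 + s + s ^ 2) * t ^ 2 / 2 + (s + s ^ 2) * t).

Lemma cubicQ_deriv k s t : derivable_pt_lim (cubicQ k s) t (cubic k s t).
Proof.
  apply is_derive_Reals. unfold cubicQ, cubic. auto_derive; [exact I|]. field.
Qed.

Lemma cubicQ_total k s : cubicQ k s 1 - cubicQ k s s = - (k * (1 - s) ^ 3 * (1 + s) / 4).
Proof. unfold cubicQ. field. Qed.

(** The factor 3 bounds [(1 - t)(t - s)]. The statement is local so that a lower bound on the
    dissipation known only on a short interval can be used. *)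
Lemma orbit_energy_gain {k eta F a p s y} (O : orbit F a p 1 s y) x z c :
  -2 <= s -> 0 <= eta -> 0 <= a -> near_cubic k eta s F -> s <= x < z -> z <= 1 ->
  (forall t, x < t < z -> c <= a * (Rpower (y t) p * y t)) ->
  (c - 3 * eta) * (z - x) <= (y z ^ 2 / 2 - cubicQ k s z) - (y x ^ 2 / 2 - cubicQ k s x).
Proof.
  intros Hs He Ha HF Hx Hz Hc. pose proof O as (_ & Cy & _).
  destruct (mvt_open (fun t => y t ^ 2 / 2 - cubicQ k s t)
     (fun t => F t + a * (Rpower (y t) p * y t) - cubic k s t) x z) as (m & Hm & E).
  - lra.
  - intros t Ht. apply derivable_pt_lim_minus; [apply (orbit_energy_deriv O); lra|apply cubicQ_deriv].
  - intros t Ht. apply continuity_pt_minus; [apply half_square_continuity, Cy|].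
    eapply dpl_continuity_pt, cubicQ_deriv.
  - cbv beta in E. rewrite E. apply Rmult_le_compat_r; [lra|].
    specialize (Hc m Hm). specialize (HF m ltac:(lra)). apply Rabs_le_between in HF.
    assert ((1 - m) * (m - s) <= 3) by nra.
    pose proof (Rmult_le_compat_l eta _ _ He H). lra.
Qed.

Lemma cubic_bound k s t : 0 < k -> -2 <= s <= 0 -> s <= t <= 1 -> Rabs (cubic k s t) <= 27 * k.
Proof.
  intros Hk Hs Ht. unfold cubic. rewrite !Rabs_mult, (Rabs_right k) by lra.
  assert (Rabs (t - 1) <= 3) by (apply Rabs_le; lra).
  assert (Rabs (t - s) <= 3) by (apply Rabs_le; lra).
  assert (Rabs (t + 1 + s) <= 3) by (apply Rabs_le; lra).
  pose proof (Rabs_pos (t - 1)). pose proof (Rabs_pos (t - s)). pose proof (Rabs_pos (t + 1 + s)).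
  assert (Rabs (t - 1) * Rabs (t - s) <= 3 * 3) by (apply Rmult_le_compat; assumption).
  assert (Rabs (t - 1) * Rabs (t - s) * Rabs (t + 1 + s) <= 3 * 3 * 3).
  { apply Rmult_le_compat; try assumption. apply Rmult_le_pos; assumption. }
  rewrite !Rmult_assoc in *. nra.
Qed.

(** Since [y] vanishes at [t = 1] and friction makes [y^2] grow with [t], the force alone bounds the
    speed, independently of [a]. The dissipation is then of order [a], and the energy balance makes
    [1 + s] small. *)
Lemma small_friction k p eps : 0 < k -> 0 <= p -> 0 < eps ->
  exists a0 eta0, 0 < a0 /\ 0 < eta0 /\
    forall a eta s s0, 0 <= a <= a0 -> 0 < eta <= eta0 ->
      scaled_wave k eta a p s s0 -> s <= -1 + eps.
Proof.
  (* [Y] is twice [3 (27 k + 3)], a bound for [y^2]; as it exceeds 1 it also bounds [y]. *)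
  intros Hk Hp He. set (Y := 162 * k + 18). set (C := Rpower Y p * Y).
  assert (HC : 0 < C) by (apply Rmult_lt_0_compat; [apply Rpower_pos|unfold Y; lra]).
  exists (k * eps / 100 / C), (Rmin (1/2) (k * eps / 100)).
  assert (Hke : 0 < k * eps) by (apply Rmult_lt_0_compat; lra).
  split; [apply Rdiv_lt_0_compat; lra|]. split; [apply Rmin_pos; lra|].
  intros a eta s s0 Ha Heta (Hs & _ & F & y & O & HF & _).
  pose proof (Rmin_l (1/2) (k * eps / 100)). pose proof (Rmin_r (1/2) (k * eps / 100)).
  pose proof O as (_ & Cy & Yl & Yr & Py & _).
  assert (Yb : forall t, s < t < 1 -> y t <= Y).
  { intros t Ht. pose proof (Py t Ht).
    destruct (mvt_open (fun t => y t ^ 2 / 2) (fun t => F t + a * (Rpower (y t) p * y t)) t 1)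
      as (c & Hc & E); [lra| | |].
    - intros x Hx; apply (orbit_energy_deriv O); lra.
    - intros x _; apply half_square_continuity, Cy.
    - cbv beta in E. rewrite (Yr 1) in E by lra.
      pose proof (Rmult_le_pos _ _ (proj1 Ha) (Rmult_le_pos _ _ (Rlt_le _ _ (Rpower_pos (y c) p))
         (Rlt_le _ _ (Py c ltac:(lra))))) as Fr.
      pose proof (HF c ltac:(lra)) as B. pose proof (cubic_bound k s c Hk ltac:(lra) ltac:(lra)) as B'.
      apply Rabs_le_between in B. apply Rabs_le_between in B'.
      assert (eta * ((1 - c) * (c - s)) <= 1/2 * 3) by (apply Rmult_le_compat; nra).
      assert (- (F c + a * (Rpower (y c) p * y c)) <= 27 * k + 3) by lra.
      assert (y t ^ 2 / 2 <= (27 * k + 3) * 3).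
      { replace (y t ^ 2 / 2) with (- (F c + a * (Rpower (y c) p * y c)) * (1 - t)) by lra.
        apply Rle_trans with ((27 * k + 3) * (1 - t)); [apply Rmult_le_compat_r; lra|].
        apply Rmult_le_compat_l; lra. }
      unfold Y. nra. }
  destruct (mvt_open (fun t => y t ^ 2 / 2 - cubicQ k s t)
     (fun t => F t + a * (Rpower (y t) p * y t) - cubic k s t) s 1) as (m & Hm & E).
  - lra.
  - intros t Ht. apply derivable_pt_lim_minus; [apply (orbit_energy_deriv O); lra|apply cubicQ_deriv].
  - intros t Ht. apply continuity_pt_minus; [apply half_square_continuity, Cy|].
    eapply dpl_continuity_pt, cubicQ_deriv.
  - cbv beta in E. rewrite (Yr 1), (Yl s) in E by lra.
    pose proof (cubicQ_total k s) as Tot.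
    pose proof (HF m ltac:(lra)) as B. apply Rabs_le_between in B.
    assert (eta * ((1 - m) * (m - s)) <= k * eps / 100 * 3) by (apply Rmult_le_compat; nra).
    pose proof (Py m Hm) as Pm.
    pose proof (Rpower_mul_le (y m) Y p Hp ltac:(pose proof (Yb m Hm); lra)) as RB. fold C in RB.
    assert (a * (Rpower (y m) p * y m) <= k * eps / 100).
    { replace (k * eps / 100) with (k * eps / 100 / C * C) by (field; lra).
      apply Rmult_le_compat; try lra. apply Rmult_le_pos; [apply Rlt_le, Rpower_pos|lra]. }
    assert (k * (1 - s) ^ 3 * (1 + s) / 4 <= k * eps / 25 * 3).
    { replace (k * (1 - s) ^ 3 * (1 + s) / 4)
        with ((F m + a * (Rpower (y m) p * y m) - cubic k s m) * (1 - s)) by lra.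
      apply Rle_trans with (k * eps / 25 * (1 - s)).
      - apply Rmult_le_compat_r; lra.
      - apply Rmult_le_compat_l; lra. }
    apply Rnot_lt_le; intros Hc.
    assert (1 <= (1 - s) ^ 3) by (apply pow_R1_Rle; lra).
    assert (k * eps * 1 <= k * (1 + s) * (1 - s) ^ 3).
    { apply Rmult_le_compat; try lra. apply Rmult_le_compat_l; lra. }
    lra.
Qed.

(* The right-hand side is minus the integral of the cubic over [(s, 1)]; the speed is at least [y1]
   on an interval of length [e / 2], which bounds the dissipation from below. *)
Lemma friction_gap k eta a p s s0 e : 0 < k -> 0 <= p -> 0 <= a -> 0 < e <= 1/4 ->
  0 < eta <= 1 -> eta <= k * e / 2 -> scaled_wave k eta a p s s0 -> s <= -1/2 - e ->
  let y1 := sqrt (k * e ^ 3 / 8) in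
  a * (Rpower y1 p * y1) * e / 2 - 9 * eta <= k * (1 - s) ^ 3 * (1 + s) / 4.
Proof.
  intros Hk Hp Ha He Heta Heta' (Hs & _ & F & y & O & HF & _) Hse y1.
  pose proof O as (_ & Cy & Yl & Yr & Py & _).
  assert (Hke : 0 < k * e) by (apply Rmult_lt_0_compat; lra).
  assert (Hke3 : 0 < k * e ^ 3 / 8).
  { apply Rdiv_lt_0_compat; [|lra]. apply Rmult_lt_0_compat; [lra|apply pow_lt; lra]. }
  assert (Hy1 : 0 < y1) by (apply sqrt_lt_R0; exact Hke3).
  assert (Hy1sq : y1 * y1 = k * e ^ 3 / 8) by (apply sqrt_sqrt; lra).
  (* Here [t + 1 + s <= - e] and [1 - t >= 1]; the error uses up at most half of the factor
     [k e]. *)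
  assert (Fpos : forall t, s <= t <= s + e -> k * e / 2 * (t - s) <= F t).
  { intros t Ht. specialize (HF t ltac:(lra)). apply Rabs_le_between in HF.
    assert (G : k * e / 2 * (t - s) <= (1 - t) * (t - s) * (- (k * (t + 1 + s)) - eta)).
    { assert (k * e <= - (k * (t + 1 + s))).
      { replace (- (k * (t + 1 + s))) with (k * (- (t + 1 + s))) by ring.
        apply Rmult_le_compat_l; lra. }
      apply Rle_trans with ((t - s) * (k * e / 2)); [right; ring|].
      apply Rmult_le_compat; try lra. nra. }
    unfold cubic in HF. nra. }
  assert (Pgrow : forall t, s <= t <= s + e -> k * e / 4 * (t - s) ^ 2 <= y t ^ 2 / 2).
  { intros t Ht.
    assert (y s ^ 2 / 2 - k * e / 4 * (s - s) ^ 2 <= y t ^ 2 / 2 - k * e / 4 * (t - s) ^ 2).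
    { apply (nondecreasing_of_deriv (fun t => y t ^ 2 / 2 - k * e / 4 * (t - s) ^ 2)
         (fun t => F t + a * (Rpower (y t) p * y t) - k * e / 2 * (t - s)) s t); [lra| | |].
      - intros x Hx. apply derivable_pt_lim_minus; [apply (orbit_energy_deriv O); lra|].
        apply is_derive_Reals. auto_derive; [exact I|field].
      - intros x Hx. apply continuity_pt_minus; [apply half_square_continuity, Cy|].
        eapply dpl_continuity_pt, is_derive_Reals. auto_derive; [exact I|reflexivity].
      - intros x Hx. specialize (Fpos x ltac:(lra)).
        pose proof (Rmult_le_pos _ _ Ha (Rmult_le_pos _ _ (Rlt_le _ _ (Rpower_pos (y x) p))
         (Rlt_le _ _ (Py x ltac:(lra))))). lra. }
    rewrite (Yl s) in H by lra. replace (s - s) with 0 in H by ring. lra. }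
  (* At distance [e / 2] from [s] the lower bound on the energy is [k e^3 / 16 = y1^2 / 2]. *)
  assert (Ylow : forall t, s + e / 2 <= t <= s + e -> y1 <= y t).
  { intros t Ht. specialize (Pgrow t ltac:(lra)). pose proof (Py t ltac:(lra)).
    assert ((e / 2) ^ 2 <= (t - s) ^ 2) by (apply pow_incr; lra).
    assert (k * e / 4 * (e / 2) ^ 2 <= k * e / 4 * (t - s) ^ 2) by (apply Rmult_le_compat_l; lra).
    replace (k * e / 4 * (e / 2) ^ 2) with (y1 * y1 / 2) in H1 by (rewrite Hy1sq; field). nra. }
  set (c := a * (Rpower y1 p * y1)).
  assert (Nn : forall t, s < t < 1 -> 0 <= a * (Rpower (y t) p * y t)).
  { intros t Ht. apply Rmult_le_pos; [exact Ha|]. apply Rmult_le_pos; [apply Rlt_le, Rpower_pos|].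
    apply Rlt_le, Py, Ht. }
  pose proof (orbit_energy_gain (k := k) (eta := eta) O s (s + e / 2) 0 ltac:(lra) ltac:(lra) Ha HF ltac:(lra) ltac:(lra)
     ltac:(intros; apply Nn; lra)) as G1.
  pose proof (orbit_energy_gain (k := k) (eta := eta) O (s + e / 2) (s + e) c ltac:(lra) ltac:(lra) Ha HF ltac:(lra) ltac:(lra)) as G2.
  pose proof (orbit_energy_gain (k := k) (eta := eta) O (s + e) 1 0 ltac:(lra) ltac:(lra) Ha HF ltac:(lra) ltac:(lra)
     ltac:(intros; apply Nn; lra)) as G3.
  assert (G2' : (c - 3 * eta) * (s + e - (s + e / 2)) <=
     y (s + e) ^ 2 / 2 - cubicQ k s (s + e) - (y (s + e / 2) ^ 2 / 2 - cubicQ k s (s + e / 2))).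
  { apply G2. intros t Ht. apply Rmult_le_compat_l; [exact Ha|]. apply Rpower_mul_le; [exact Hp|].
    split; [exact Hy1|apply Ylow; lra]. }
  rewrite (Yr 1) in G3 by lra. rewrite (Yl s) in G1 by lra.
  pose proof (cubicQ_total k s) as Tot.
  assert (eta * (1 - s) <= eta * 3) by (apply Rmult_le_compat_l; lra).
  lra.
Qed.

(** The available energy is at most [27 k / 4], because [1 - s <= 3], whereas the dissipation grows
    linearly in [a] as long as [s] stays below [-1/2 - e]. *)
Lemma large_friction k p e : 0 < k -> 0 <= p -> 0 < e ->
  exists a1 eta0, 0 < a1 /\ 0 < eta0 /\
    forall a eta s s0, a1 <= a -> 0 < eta <= eta0 ->
      scaled_wave k eta a p s s0 -> -1/2 - e <= s.
Proof.
  intros Hk Hp He0. set (e' := Rmin e (1/4)).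
  assert (He : 0 < e' <= 1/4) by (unfold e'; split; [apply Rmin_pos; lra|apply Rmin_r]).
  assert (Hee : e' <= e) by apply Rmin_l.
  set (y1 := sqrt (k * e' ^ 3 / 8)).
  assert (Hke3 : 0 < k * e' ^ 3 / 8).
  { apply Rdiv_lt_0_compat; [|lra]. apply Rmult_lt_0_compat; [lra|apply pow_lt; lra]. }
  assert (Hy1 : 0 < y1) by (apply sqrt_lt_R0; exact Hke3).
  set (c := Rpower y1 p * y1 * e' / 2).
  assert (Hc : 0 < c).
  { unfold c. repeat apply Rmult_lt_0_compat; try lra. apply Rpower_pos. }
  assert (Hke : 0 < k * e') by (apply Rmult_lt_0_compat; lra).
  exists ((27 * k + 10) / c), (Rmin 1 (k * e' / 2)).
  split; [apply Rdiv_lt_0_compat; lra|]. split; [apply Rmin_pos; lra|].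
  intros a eta s s0 Ha Heta SW.
  pose proof (Rmin_l 1 (k * e' / 2)). pose proof (Rmin_r 1 (k * e' / 2)).
  apply Rnot_lt_le; intros Hs.
  assert (Ha0 : 0 < a).
  { eapply Rlt_le_trans; [|exact Ha]. apply Rdiv_lt_0_compat; lra. }
  pose proof (friction_gap k eta a p s s0 e' Hk Hp ltac:(lra) He ltac:(lra) ltac:(lra) SW ltac:(lra)) as G.
  cbv zeta in G. fold y1 in G.
  replace (a * (Rpower y1 p * y1) * e' / 2) with (a * c) in G by (unfold c; field).
  assert (27 * k + 10 <= a * c).
  { apply Rmult_le_compat_r with (r := c) in Ha; [|lra].
    replace ((27 * k + 10) / c * c) with (27 * k + 10) in Ha by (field; lra). exact Ha. }
  destruct SW as (Hs' & _).
  assert ((1 - s) ^ 3 <= 27) by (replace 27 with (3 ^ 3) by ring; apply pow_incr; lra).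
  assert (0 <= (1 - s) ^ 3) by (apply pow_le; lra).
  assert ((1 - s) ^ 3 * (1 + s) <= 27 * 1).
  { destruct (Rle_lt_dec 0 (1 + s)); [apply Rmult_le_compat; lra|].
    pose proof (Rmult_le_pos _ (- (1 + s)) H3 ltac:(lra)). lra. }
  pose proof (Rmult_le_compat_l k _ _ ltac:(lra) H4). lra.
Qed.

(** For [s <= -3/4] a fixed friction dissipates at least [g], and the error costs at most [g / 2];
    with [1 + s] below [g / (27 k)] only [g / 4] would be available. *)
Lemma end_above_minus_one k a p : 0 < k -> 0 <= p -> 0 < a ->
  exists c eta0, 0 < c /\ 0 < eta0 /\
    forall eta s s0, 0 < eta <= eta0 -> scaled_wave k eta a p s s0 -> -1 + c <= s.
Proof.
  intros Hk Hp Ha.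
  set (y1 := sqrt (k * (1/4) ^ 3 / 8)).
  assert (Hy1 : 0 < y1) by (apply sqrt_lt_R0; lra).
  set (g := a * (Rpower y1 p * y1) * (1/4) / 2).
  assert (Hg : 0 < g).
  { unfold g. repeat apply Rmult_lt_0_compat; try lra. apply Rpower_pos. }
  exists (Rmin (1/4) (g / (27 * k))), (Rmin (Rmin 1 (k / 8)) (g / 18)).
  split; [apply Rmin_pos; [lra|apply Rdiv_lt_0_compat; lra]|].
  split; [repeat apply Rmin_pos; lra|].
  intros eta s s0 Heta SW.
  pose proof (Rmin_l (Rmin 1 (k / 8)) (g / 18)). pose proof (Rmin_r (Rmin 1 (k / 8)) (g / 18)).
  pose proof (Rmin_l 1 (k / 8)). pose proof (Rmin_r 1 (k / 8)).
  pose proof (Rmin_l (1/4) (g / (27 * k))). pose proof (Rmin_r (1/4) (g / (27 * k))).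
  apply Rnot_lt_le; intros Hs.
  pose proof (friction_gap k eta a p s s0 (1/4) Hk Hp ltac:(lra) ltac:(lra) ltac:(lra) ltac:(lra) SW ltac:(lra)) as G.
  cbv zeta in G. fold y1 in G. fold g in G.
  destruct SW as (Hs' & _).
  assert ((1 - s) ^ 3 <= 27) by (replace 27 with (3 ^ 3) by ring; apply pow_incr; lra).
  assert (0 <= (1 - s) ^ 3) by (apply pow_le; lra).
  assert (H7 : (1 - s) ^ 3 * (1 + s) <= 27 * (g / (27 * k))).
  { destruct (Rle_lt_dec 0 (1 + s)); [apply Rmult_le_compat; lra|].
    pose proof (Rmult_le_pos _ (- (1 + s)) H6 ltac:(lra)).
    assert (0 < g / (27 * k)) by (apply Rdiv_lt_0_compat; lra). lra. }
  pose proof (Rmult_le_compat_l k _ _ ltac:(lra) H7).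
  replace (k * (27 * (g / (27 * k)))) with g in H8 by (field; lra). lra.
Qed.

(** For [s1 < s2] the cubics differ by [1 - t] times [k (s2 - s1)] times [- (1 + s1 + s2)], and the
    last factor is at least [2 c]. The errors contain [1 - t] too, so ends too far apart would order
    the forces on all of [(s2, 1)], against [orbit_unique_end]. *)
Lemma scaled_ends_close k eta a p s1 s01 s2 s02 c : 0 < k -> 0 <= p -> 0 <= a -> 0 < c ->
  0 < eta <= 1 -> scaled_wave k eta a p s1 s01 -> scaled_wave k eta a p s2 s02 ->
  s1 <= -1/2 - c -> s2 <= -1/2 - c -> Rabs (s1 - s2) * (k * c) <= 3 * eta.
Proof.
  intros Hk Hp Ha Hc He.
  assert (K : forall s1 s01 s2 s02, scaled_wave k eta a p s1 s01 -> scaled_wave k eta a p s2 s02 ->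
     s1 <= -1/2 - c -> s2 <= -1/2 - c -> (s2 - s1) * (k * c) <= 3 * eta).
  { clear s1 s01 s2 s02.
    intros s1 s01 s2 s02 (Hs1 & _ & F1 & y1 & O1 & HF1 & _) (Hs2 & _ & F2 & y2 & O2 & HF2 & _) L1 L2.
    apply Rnot_lt_le; intros H.
    assert (Hkc : 0 < k * c) by (apply Rmult_lt_0_compat; assumption).
    assert (H12 : s1 < s2) by nra.
    apply (orbit_unique_end F1 F2 a p 1 s1 s2 y1 y2 Ha Hp O1 O2 H12).
    intros t Ht. specialize (HF1 t ltac:(lra)). specialize (HF2 t ltac:(lra)).
    apply Rabs_le_between in HF1. apply Rabs_le_between in HF2.
    assert (E : cubic k s1 t - cubic k s2 t = (1 - t) * (k * (s2 - s1) * - (1 + s1 + s2)))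
      by (unfold cubic; ring).
    assert (k * (s2 - s1) * (2 * c) <= k * (s2 - s1) * - (1 + s1 + s2)).
    { apply Rmult_le_compat_l; [|lra]. apply Rmult_le_pos; lra. }
    assert (eta * (t - s1) <= eta * 3) by (apply Rmult_le_compat_l; lra).
    assert (eta * (t - s2) <= eta * 3) by (apply Rmult_le_compat_l; lra).
    assert (0 <= (1 - t) * (k * (s2 - s1) * - (1 + s1 + s2) - eta * (t - s1) - eta * (t - s2))).
    { apply Rmult_le_pos; lra. }
    lra. }
  intros S1 S2 L1 L2. unfold Rabs. destruct (Rcase_abs (s1 - s2)).
  - pose proof (K _ _ _ _ S1 S2 L1 L2). lra.
  - pose proof (K _ _ _ _ S2 S1 L2 L1). lra.
Qed.

(* For the square-root friction law, [(a (t - s) + b)^2] is a supersolution leaving [t = s]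
   that stays quartically small in energy, below the cubic energy deficit at a tangency. *)
Lemma end_below_minus_half k a : 0 < k -> 0 < a ->
  exists c eta0, 0 < c /\ 0 < eta0 /\
    forall eta s s0, 0 < eta <= eta0 -> scaled_wave k eta a (1/2) s s0 -> s <= -1/2 - c.
Proof.
  intros Hk Ha.
  (* In the final balance at [s + x1] the friction contributes at most [8 a^4 x1^4], which this
     choice keeps below [k x1^3 / 24]; [th] contributes no more than that, while the force removes
     [k x1^3 / 6]. *)
  set (x1 := Rmin (1/2) (k / (192 * a ^ 4))).
  assert (Ha4 : 0 < a ^ 4) by (apply pow_lt; exact Ha).
  assert (Hx1 : 0 < x1 /\ x1 <= 1/2 /\ 192 * a ^ 4 * x1 <= k).
  { unfold x1. split; [apply Rmin_pos; [lra|apply Rdiv_lt_0_compat; lra]|]. split; [apply Rmin_l|].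
    pose proof (Rmin_r (1/2) (k / (192 * a ^ 4))).
    apply Rmult_le_compat_l with (r := 192 * a ^ 4) in H; [|lra].
    replace (192 * a ^ 4 * (k / (192 * a ^ 4))) with k in H by (field; lra). exact H. }
  destruct Hx1 as (Hx0 & Hx12 & Hxk).
  set (b := a * x1). assert (Hb : 0 < b) by (apply Rmult_lt_0_compat; assumption).
  assert (Hb3 : 0 < a * b ^ 3) by (apply Rmult_lt_0_compat; [lra|apply pow_lt; exact Hb]).
  assert (Hkx : 0 < k * x1) by (apply Rmult_lt_0_compat; assumption).
  set (th := Rmin (a * b ^ 3) (k * x1 / 24)).
  assert (Hth : 0 < th /\ th <= a * b ^ 3 /\ th <= k * x1 / 24).
  { unfold th. split; [apply Rmin_pos; lra|]. split; [apply Rmin_l|apply Rmin_r]. }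
  destruct Hth as (Hth0 & Hth1 & Hth2).
  exists (Rmin (1/4) (th / (4 * k))), (Rmin (1/4) (th / 2)).
  split; [apply Rmin_pos; [lra|apply Rdiv_lt_0_compat; lra]|]. split; [apply Rmin_pos; lra|].
  intros eta s s0 Heta (Hs & _ & F & y & O & HF & _).
  pose proof (Rmin_l (1/4) (th / (4 * k))) as M1. pose proof (Rmin_r (1/4) (th / (4 * k))) as M2.
  pose proof (Rmin_l (1/4) (th / 2)). pose proof (Rmin_r (1/4) (th / 2)).
  set (sg := Rmin (1/4) (th / (4 * k))) in *.
  assert (Hksg : k * sg <= th / 4).
  { apply Rmult_le_compat_l with (r := k) in M2; [|lra].
    replace (k * (th / (4 * k))) with (th / 4) in M2 by (field; lra). exact M2. }
  apply Rnot_lt_le; intros Hc.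
  pose proof O as (_ & Cy & Yl & Yr & Py & _).
  (* The third root [- 1 - s] is less than [2 sg] above [s], so up to a term of size [th] the force
     is bounded by a negative quadratic. *)
  assert (FB : forall t, s <= t <= s + x1 -> F t <= 2 * th * (t - s) - k * (t - s) ^ 2 / 2).
  { intros t Ht. specialize (HF t ltac:(lra)). apply Rabs_le_between in HF.
    assert (B1 : - (k * (t + 1 + s)) + eta <= th - k * (t - s)).
    { assert (k * - (t + 1 + s) <= k * (2 * sg - (t - s))) by (apply Rmult_le_compat_l; lra). lra. }
    assert (B2 : F t <= (1 - t) * (t - s) * (th - k * (t - s))).
    { assert ((1 - t) * (t - s) * (- (k * (t + 1 + s)) + eta) <= (1 - t) * (t - s) * (th - k * (t - s))).
      { apply Rmult_le_compat_l; [|exact B1]. apply Rmult_le_pos; lra. }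
      unfold cubic in HF. lra. }
    assert (B3 : (1 - t) * ((t - s) * th) <= 2 * ((t - s) * th)).
    { apply Rmult_le_compat_r; [apply Rmult_le_pos|]; lra. }
    assert (B4 : / 2 * (k * (t - s) ^ 2) <= (1 - t) * (k * (t - s) ^ 2)).
    { apply Rmult_le_compat_r; [apply Rmult_le_pos; [lra|apply pow2_ge_0]|lra]. }
    lra. }
  set (m := fun t => a * (t - s) + b).
  assert (Mpos : forall t, s <= t -> b <= m t).
  { intros t Ht. unfold m. pose proof (Rmult_le_pos a (t - s) ltac:(lra) ltac:(lra)). lra. }
  assert (Fric : forall t, s < t < 1 -> y t <= m t ^ 2 -> Rpower (y t) (1/2) * y t <= m t ^ 3).
  { intros t Ht Hm. pose proof (Py t Ht) as Hy. pose proof (Mpos t ltac:(lra)).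
    assert (Rpower (y t) (1/2) <= m t).
    { apply Rle_trans with (Rpower (m t ^ 2) (1/2)); [apply Rle_Rpower_l; lra|].
      rewrite <- (Rpower_pow 2 (m t)), Rpower_mult by lra.
      replace (INR 2 * (1/2)) with 1 by (simpl; field). rewrite Rpower_1; lra. }
    replace (m t ^ 3) with (m t * m t ^ 2) by ring.
    apply Rmult_le_compat; try lra. apply Rlt_le, Rpower_pos. }
  (* [m^2] times its derivative is [2 a m^3]: one half pays for the friction, the other is at least
     [a b^3 >= th] and pays for the force, as [t - s <= 1/2]. *)
  assert (YB : forall z, s < z <= s + x1 -> y z <= m z ^ 2).
  { intros z Hz. apply Rnot_lt_le; intros Hyz.
    assert (0 < (m z ^ 2) ^ 2 / 2 - y z ^ 2 / 2); [|pose proof (pow2_ge_0 (m z)); nra].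
    apply (pos_persists (fun t => (m t ^ 2) ^ 2 / 2 - y t ^ 2 / 2)
      (fun t => 2 * a * m t ^ 3 - (F t + a * (Rpower (y t) (1/2) * y t))) s z).
    - lra.
    - intros t Ht. apply derivable_pt_lim_minus; [|apply (orbit_energy_deriv O); lra].
      apply is_derive_Reals. unfold m. auto_derive; [exact I|]. field.
    - intros t Ht. apply continuity_pt_minus; [|apply half_square_continuity, Cy].
      eapply dpl_continuity_pt, is_derive_Reals. unfold m. auto_derive; [exact I|reflexivity].
    - intros t Ht Hpos. pose proof (Py t ltac:(lra)). pose proof (pow2_ge_0 (m t)).
      assert (Hle : y t <= m t ^ 2) by nra.
      pose proof (Fric t ltac:(lra) Hle) as Fr. specialize (FB t ltac:(lra)).
      pose proof (Mpos t ltac:(lra)).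
      assert (b ^ 3 <= m t ^ 3) by (apply pow_incr; lra).
      assert (a * b ^ 3 <= a * m t ^ 3) by (apply Rmult_le_compat_l; lra).
      assert (a * (Rpower (y t) (1/2) * y t) <= a * m t ^ 3) by (apply Rmult_le_compat_l; lra).
      assert (2 * th * (t - s) <= 2 * th * (1/2)) by (apply Rmult_le_compat_l; lra).
      assert (0 <= k * (t - s) ^ 2) by (apply Rmult_le_pos; [lra|apply pow2_ge_0]). lra.
    - rewrite (Yl s) by lra. assert (0 < (m s ^ 2) ^ 2).
      { apply pow_lt, pow_lt. specialize (Mpos s ltac:(lra)). lra. } lra. }
  pose proof (Py (s + x1) ltac:(lra)) as Pend.
  assert (E : y (s + x1) ^ 2 / 2 <= th * x1 ^ 2 - k * x1 ^ 3 / 6 + a * (2 * b) ^ 3 * x1).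
  { set (Z := fun t => th * (t - s) ^ 2 - k * (t - s) ^ 3 / 6 + a * (2 * b) ^ 3 * (t - s)).
    assert (Z s - y s ^ 2 / 2 <= Z (s + x1) - y (s + x1) ^ 2 / 2).
    { apply (nondecreasing_of_deriv (fun t => Z t - y t ^ 2 / 2)
        (fun t => 2 * th * (t - s) - k * (t - s) ^ 2 / 2 + a * (2 * b) ^ 3
                  - (F t + a * (Rpower (y t) (1/2) * y t)))); [lra| | |].
      - intros t Ht. apply derivable_pt_lim_minus; [|apply (orbit_energy_deriv O); lra].
        apply is_derive_Reals. unfold Z. auto_derive; [exact I|]. field.
      - intros t Ht. apply continuity_pt_minus; [|apply half_square_continuity, Cy].
        eapply dpl_continuity_pt, is_derive_Reals. unfold Z. auto_derive; [exact I|reflexivity].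
      - intros t Ht. specialize (FB t ltac:(lra)).
        pose proof (Fric t ltac:(lra) (YB t ltac:(lra))) as Fr. pose proof (Mpos t ltac:(lra)).
        assert (m t ^ 3 <= (2 * b) ^ 3).
        { apply pow_incr. split; [lra|]. unfold m, b.
          pose proof (Rmult_le_compat_l a (t - s) x1 ltac:(lra) ltac:(lra)). lra. }
        assert (a * (Rpower (y t) (1/2) * y t) <= a * (2 * b) ^ 3) by (apply Rmult_le_compat_l; lra).
        lra. }
    rewrite (Yl s) in H1 by lra. unfold Z in H1.
    replace (s + x1 - s) with x1 in H1 by ring. replace (s - s) with 0 in H1 by ring. lra. }
  assert (P3 : 0 < x1 ^ 3) by (apply pow_lt; exact Hx0).
  assert (T1 : th * x1 ^ 2 <= k * x1 / 24 * x1 ^ 2) by (apply Rmult_le_compat_r; [apply pow2_ge_0|exact Hth2]).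
  assert (T2 : 192 * a ^ 4 * x1 * x1 ^ 3 <= k * x1 ^ 3) by (apply Rmult_le_compat_r; lra).
  replace (a * (2 * b) ^ 3 * x1) with (192 * a ^ 4 * x1 * x1 ^ 3 / 24) in E by (unfold b; field).
  pose proof (Rmult_lt_0_compat _ _ Hk P3). nra.
Qed.

(** * Linear friction and parabolic barriers *)

Lemma parabola_deriv c s t :
  derivable_pt_lim (fun t => c * (1 - t) * (t - s)) t (c * (1 + s - 2 * t)).
Proof. apply is_derive_Reals. auto_derive; [exact I|ring]. Qed.

Lemma parabola_continuity c s t : continuity_pt (fun t => c * (1 - t) * (t - s)) t.
Proof. eapply dpl_continuity_pt, parabola_deriv. Qed.

(* With linear friction [3 c (1 + s)] the exact orbit of the cubic [2 c^2 (t-1)(t-s)(t+1+s)] is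
   the parabola [c (1 - t)(t - s)]; the critical friction [3 c / 2] is the case [s = -1/2]. *)
Lemma supercritical_end c e : 0 < c -> 0 < e ->
  exists eta0, 0 < eta0 /\
    forall eta s s0, 0 < eta <= eta0 ->
      scaled_wave (2 * c ^ 2) eta (3 * c / 2 + e) 0 s s0 -> s = s0.
Proof.
  intros Hc He. set (a := 3 * c / 2 + e).
  set (dl := Rmin (1/4) (e / (2 * c))).
  assert (Hdl : 0 < dl /\ dl <= 1/4 /\ c * dl <= e / 2).
  { unfold dl. split; [apply Rmin_pos; [lra|apply Rdiv_lt_0_compat; lra]|]. split; [apply Rmin_l|].
    pose proof (Rmin_r (1/4) (e / (2 * c))).
    apply Rmult_le_compat_l with (r := c) in H; [|lra].
    replace (c * (e / (2 * c))) with (e / 2) in H by (field; lra). exact H. }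
  destruct Hdl as (Hdl0 & Hdl1 & Hdl2).
  assert (Hc2 : 0 < c ^ 2) by (apply pow_lt; exact Hc).
  assert (Hec : 0 < e * c) by (apply Rmult_lt_0_compat; assumption).
  assert (Hdd : 0 < c ^ 2 * dl ^ 2) by (apply Rmult_lt_0_compat; [exact Hc2|apply pow_lt; lra]).
  exists (Rmin (1/4) (Rmin (e * c / (1 + 3 * c ^ 2)) (c ^ 2 * dl ^ 2 / 2))).
  split; [repeat apply Rmin_pos; try lra; apply Rdiv_lt_0_compat; lra|].
  intros eta s s0 Heta (Hs & _ & F & y & O & HF & Hpos & _).
  pose proof (Rmin_l (1/4) (Rmin (e * c / (1 + 3 * c ^ 2)) (c ^ 2 * dl ^ 2 / 2))).
  pose proof (Rmin_r (1/4) (Rmin (e * c / (1 + 3 * c ^ 2)) (c ^ 2 * dl ^ 2 / 2))).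
  pose proof (Rmin_l (e * c / (1 + 3 * c ^ 2)) (c ^ 2 * dl ^ 2 / 2)).
  pose proof (Rmin_r (e * c / (1 + 3 * c ^ 2)) (c ^ 2 * dl ^ 2 / 2)).
  assert (He1 : eta * (1 + 3 * c ^ 2) <= e * c).
  { replace (e * c) with (e * c / (1 + 3 * c ^ 2) * (1 + 3 * c ^ 2)) by (field; lra).
    apply Rmult_le_compat_r; lra. }
  pose proof O as (_ & Cy & Yl & Yr & Py & Dy).
  assert (Ha : 0 <= a) by (unfold a; lra).
  apply NNPP; intros Hne. destruct (Hpos Hne) as (xi & Hxi & HFp).
  assert (Par : forall s' t, s' < t < 1 -> 0 < c * (1 - t) * (t - s')).
  { intros s' t Ht. repeat apply Rmult_lt_0_compat; lra. }
  (* Close to -1/2, two slopes at [s] conflict: where [F >= 0] the speed grows at rate at least [a],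
     while the parabola above it allows at most [3 c / 2 + e / 2]. *)
  destruct (Rle_lt_dec (-1/2 - dl) s) as [Hsd|Hsd].
  - set (t := s + Rmin xi 1 / 2).
    pose proof (Rmin_l xi 1). pose proof (Rmin_r xi 1).
    assert (0 < Rmin xi 1) by (apply Rmin_pos; lra).
    assert (Ht : s < t < 1 /\ t < s + xi) by (unfold t; lra).
    assert (U : y t <= c * (1 - t) * (t - s)).
    { apply (upper_barrier O (fun t => c * (1 - t) * (t - s)) (fun t => c * (1 + s - 2 * t)) t).
      - exact Ha.
      - lra.
      - lra.
      - intros; apply parabola_deriv.
      - intros; apply parabola_continuity.
      - intros; apply Par; lra.
      - apply Rlt_le, Par; lra.
      - intros x Hx. rewrite Rpower_O by (apply Par; lra). rewrite Rmult_1_l.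
        specialize (HF x ltac:(lra)). apply Rabs_le_between in HF.
        assert (0 <= (1 - x) * (x - s) * (a * c - 3 * c ^ 2 * (1 + s) - eta)).
        { apply Rmult_le_pos; [apply Rmult_le_pos; lra|].
          assert (3 * c ^ 2 * (1 + s) <= 3 * c ^ 2 * (1/2 + eta)) by (apply Rmult_le_compat_l; lra).
          unfold a. lra. }
        unfold cubic in HF. lra. }
    assert (L : a * (t - s) <= y t).
    { assert (y s - a * (s - s) <= y t - a * (t - s)); [|rewrite (Yl s) in H6 by lra; lra].
      apply (nondecreasing_of_deriv (fun t => y t - a * (t - s))
         (fun t => F t / y t + a * Rpower (y t) 0 - a)); [lra| | |].
      - intros x Hx. apply derivable_pt_lim_minus; [apply Dy; lra|].
        apply is_derive_Reals. auto_derive; [exact I|ring].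
      - intros x Hx. apply continuity_pt_minus; [apply Cy|].
        eapply dpl_continuity_pt, is_derive_Reals. auto_derive; [exact I|reflexivity].
      - intros x Hx. pose proof (Py x ltac:(lra)) as Pyx. rewrite Rpower_O by exact Pyx.
        specialize (HFp x ltac:(lra)).
        assert (0 <= F x / y x) by (apply Rmult_le_pos; [exact HFp|apply Rlt_le, Rinv_0_lt_compat, Pyx]).
        lra. }
    assert (a <= c * (1 - t)) by (apply Rmult_le_reg_r with (t - s); lra).
    assert (c * (1 - t) <= c * (3/2 + dl)) by (apply Rmult_le_compat_l; lra).
    unfold a in H6. lra.
  (* Away from -1/2, the barrier is the parabola ending at [sb > s]. Moving the root from [s] to
     [sb] lowers the cubic by more than the error, and the barrier would make [y] vanish inside its
     interval. *)
  - set (sb := -1/2 - dl / 2).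
    assert (U : y sb <= c * (1 - sb) * (sb - sb)).
    { apply (upper_barrier O (fun t => c * (1 - t) * (t - sb)) (fun t => c * (1 + sb - 2 * t)) sb).
      - exact Ha.
      - lra.
      - unfold sb; lra.
      - intros; apply parabola_deriv.
      - intros; apply parabola_continuity.
      - intros; apply Par; lra.
      - replace (sb - sb) with 0 by ring. lra.
      - intros x Hx. rewrite Rpower_O by (apply Par; lra). rewrite Rmult_1_l.
        assert (Hsx : s < x) by (unfold sb in Hx; lra).
        specialize (HF x ltac:(lra)). apply Rabs_le_between in HF.
        assert (Q1 : 0 <= (1 - x) * (x - sb) * (a * c - 3 * c ^ 2 * (1 + sb))).
        { apply Rmult_le_pos; [apply Rmult_le_pos; lra|].
          assert (3 * c ^ 2 * (1 + sb) <= 3 * c ^ 2 * (1/2)) by (apply Rmult_le_compat_l; unfold sb; lra).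
          unfold a. lra. }
        assert (Q2 : 0 <= (1 - x) * (2 * c ^ 2 * ((sb - s) * - (1 + s + sb)) - eta * (x - s))).
        { apply Rmult_le_pos; [lra|].
          assert (dl / 2 * (3 * dl / 2) <= (sb - s) * - (1 + s + sb))
            by (apply Rmult_le_compat; unfold sb; lra).
          assert (2 * c ^ 2 * (dl / 2 * (3 * dl / 2)) <= 2 * c ^ 2 * ((sb - s) * - (1 + s + sb)))
            by (apply Rmult_le_compat_l; lra).
          assert (eta * (x - s) <= c ^ 2 * dl ^ 2 / 2 * 3) by (apply Rmult_le_compat; lra). lra. }
        unfold cubic in HF. lra. }
    pose proof (Py sb ltac:(unfold sb; lra)). replace (sb - sb) with 0 in U by ring. lra.
Qed.

(** At tangency [F <= 0], so the speed leaves [s] at rate at most [a]; but the parabola is now a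
    lower barrier, with slope near [3 c / 2] at [s]. Comparing at distance [tau], the deviations
    [eta] and [tau] cost at most [e / 4] each. *)
Lemma subcritical_end c e : 0 < c -> 0 < e < 3 * c / 2 ->
  exists eta0, 0 < eta0 /\
    forall eta s s0, 0 < eta <= eta0 ->
      scaled_wave (2 * c ^ 2) eta (3 * c / 2 - e) 0 s s0 -> s <> s0.
Proof.
  intros Hc He. set (a := 3 * c / 2 - e).
  assert (Hc2 : 0 < c ^ 2) by (apply pow_lt; exact Hc).
  assert (Hec : 0 < e * c) by (apply Rmult_lt_0_compat; lra).
  exists (Rmin (1/4) (Rmin (e * c / (1 + 3 * c ^ 2)) (e / (4 * c)))).
  split; [repeat apply Rmin_pos; try lra; apply Rdiv_lt_0_compat; lra|].
  intros eta s s0 Heta (Hs & Hs0 & F & y & O & HF & _ & Hneg) Heq.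
  specialize (Hneg Heq). rewrite <- Heq in Hs0. apply Rabs_le_between in Hs0.
  pose proof (Rmin_l (1/4) (Rmin (e * c / (1 + 3 * c ^ 2)) (e / (4 * c)))).
  pose proof (Rmin_r (1/4) (Rmin (e * c / (1 + 3 * c ^ 2)) (e / (4 * c)))).
  pose proof (Rmin_l (e * c / (1 + 3 * c ^ 2)) (e / (4 * c))).
  pose proof (Rmin_r (e * c / (1 + 3 * c ^ 2)) (e / (4 * c))).
  assert (He1 : eta * (1 + 3 * c ^ 2) <= e * c).
  { replace (e * c) with (e * c / (1 + 3 * c ^ 2) * (1 + 3 * c ^ 2)) by (field; lra).
    apply Rmult_le_compat_r; lra. }
  pose proof O as (_ & Cy & Yl & Yr & Py & Dy).
  assert (Ha : 0 <= a) by (unfold a; lra).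
  set (tau := Rmin (1/2) (e / (4 * c))).
  assert (Htau : 0 < tau /\ tau <= 1/2 /\ tau <= e / (4 * c)).
  { unfold tau. split; [apply Rmin_pos; [lra|apply Rdiv_lt_0_compat; lra]|]. split; [apply Rmin_l|apply Rmin_r]. }
  set (t := s + tau).
  assert (Ht : s < t < 1) by (unfold t; lra).
  assert (L : c * (1 - t) * (t - s) <= y t).
  { apply (lower_barrier O (fun t => c * (1 - t) * (t - s)) (fun t => c * (1 + s - 2 * t)) t).
    - exact Ha.
    - lra.
    - lra.
    - intros; apply parabola_deriv.
    - intros; apply parabola_continuity.
    - intros; repeat apply Rmult_lt_0_compat; lra.
    - ring.
    - intros x Hx. rewrite Rpower_O by (repeat apply Rmult_lt_0_compat; lra). rewrite Rmult_1_l.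
      specialize (HF x ltac:(lra)). apply Rabs_le_between in HF.
      assert (0 <= (1 - x) * (x - s) * (3 * c ^ 2 * (1 + s) - a * c - eta)).
      { apply Rmult_le_pos; [apply Rmult_le_pos; lra|].
        assert (3 * c ^ 2 * (1/2 - eta) <= 3 * c ^ 2 * (1 + s)) by (apply Rmult_le_compat_l; lra).
        unfold a. lra. }
      unfold cubic in HF. lra. }
  assert (U : y t <= a * (t - s)).
  { assert (a * (s - s) - y s <= a * (t - s) - y t); [|rewrite (Yl s) in H3 by lra; lra].
    apply (nondecreasing_of_deriv (fun t => a * (t - s) - y t)
       (fun t => a - (F t / y t + a * Rpower (y t) 0))); [lra| | |].
    - intros x Hx. apply derivable_pt_lim_minus; [|apply Dy; lra].
      apply is_derive_Reals. auto_derive; [exact I|ring].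
    - intros x Hx. apply continuity_pt_minus; [|apply Cy].
      eapply dpl_continuity_pt, is_derive_Reals. auto_derive; [exact I|reflexivity].
    - intros x Hx. pose proof (Py x ltac:(lra)) as Pyx. rewrite Rpower_O by exact Pyx.
      specialize (Hneg x ltac:(lra)).
      assert (0 <= - F x / y x) by (apply Rmult_le_pos; [lra|apply Rlt_le, Rinv_0_lt_compat, Pyx]).
      unfold Rdiv in *. lra. }
  assert (c * (1 - t) <= a) by (apply Rmult_le_reg_r with (t - s); lra).
  assert (c * (3/2 - eta - tau) <= c * (1 - t)) by (apply Rmult_le_compat_l; unfold t; lra).
  assert (B : forall z, z <= e / (4 * c) -> c * z <= e / 4).
  { intros z Hz. replace (e / 4) with (c * (e / (4 * c))) by (field; lra). apply Rmult_le_compat_l; lra. }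
  pose proof (B eta ltac:(lra)). pose proof (B tau ltac:(lra)). unfold a in H3. lra.
Qed.

(** * Limits at the origin *)

Definition lim_ratio (q : R -> R) (L : R) : Prop :=
  forall eps, 0 < eps -> exists d, 0 < d /\ forall h, 0 < Rabs h < d -> Rabs (q h - L) < eps.

Lemma lim_ratio_deriv g L : g 0 = 0 -> lim_ratio (fun h => g h / h) L -> derivable_pt_lim g 0 L.
Proof.
  intros G0 H eps He. destruct (H eps He) as (d & Hd & D).
  exists (mkposreal d Hd). intros h Hh Hhd. simpl in Hhd.
  rewrite Rplus_0_l, G0, Rminus_0_r. apply D. split; [apply Rabs_pos_lt, Hh|exact Hhd].
Qed.

Lemma lim_ratio_le q L M d : 0 < d -> (forall h, 0 < Rabs h < d -> q h <= M) -> lim_ratio q L -> L <= M.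
Proof.
  intros Hd Hq HL. apply Rnot_lt_le; intros HM.
  destruct (HL (L - M) ltac:(lra)) as (d' & Hd' & D).
  pose proof (Rmin_l d d'). pose proof (Rmin_r d d').
  assert (0 < Rmin d d') by (apply Rmin_pos; assumption).
  assert (E : Rabs (Rmin d d' / 2) = Rmin d d' / 2) by (apply Rabs_right; lra).
  specialize (D (Rmin d d' / 2) ltac:(lra)). specialize (Hq (Rmin d d' / 2) ltac:(lra)).
  apply Rabs_def2 in D. lra.
Qed.

Lemma lim_ratio_ge q L M d : 0 < d -> (forall h, 0 < Rabs h < d -> M <= q h) -> lim_ratio q L -> M <= L.
Proof.
  intros Hd Hq HL. apply Ropp_le_cancel.
  apply (lim_ratio_le (fun h => - q h) (- L) (- M) d Hd).
  - intros h Hh; specialize (Hq h Hh); lra.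
  - intros eps He. destruct (HL eps He) as (d' & Hd' & D). exists d'; split; [exact Hd'|].
    intros h Hh. replace (- q h - - L) with (- (q h - L)) by ring. rewrite Rabs_Ropp. auto.
Qed.

Lemma lim_ratio_cauchy q :
  (forall eps, 0 < eps -> exists d, 0 < d /\
     forall h1 h2, 0 < Rabs h1 < d -> 0 < Rabs h2 < d -> Rabs (q h1 - q h2) < eps) ->
  exists L, lim_ratio q L.
Proof.
  intros H.
  assert (Small : forall d, 0 < d -> exists N, forall n, (N <= n)%nat -> 0 < Rabs (/ INR (S n)) < d).
  { intros d Hd. destruct (archimed_cor1 d Hd) as (N & HN & HN0). exists N. intros n Hn.
    assert (0 < INR N) by (apply lt_0_INR; exact HN0).
    assert (INR N < INR (S n)) by (apply lt_INR; apply le_n_S; exact Hn).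
    assert (0 < / INR (S n)) by (apply Rinv_0_lt_compat; lra).
    rewrite Rabs_right by lra. split; [assumption|].
    apply Rlt_trans with (/ INR N); [|exact HN]. apply Rinv_lt_contravar; [|assumption].
    apply Rmult_lt_0_compat; lra. }
  destruct (Rcomplete.R_complete (fun n => q (/ INR (S n)))) as [L HL].
  { intros eps He. destruct (H eps He) as (d & Hd & D). destruct (Small d Hd) as [N HN].
    exists N. intros n m Hn Hm. apply D; apply HN; assumption. }
  exists L. intros eps He. destruct (H (eps / 2) ltac:(lra)) as (d & Hd & D).
  exists d; split; [exact Hd|]. intros h Hh.
  destruct (Small d Hd) as [N1 HN1]. destruct (HL (eps / 2) ltac:(lra)) as [N2 HN2].
  set (n := Nat.max N1 N2).
  specialize (D h (/ INR (S n)) Hh (HN1 n (Nat.le_max_l _ _))).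
  specialize (HN2 n (Nat.le_max_r _ _)). unfold Rdist in HN2.
  apply Rabs_def2 in D. apply Rabs_def2 in HN2. apply Rabs_def1; lra.
Qed.

Lemma Rpower_small q eps : 0 < q -> 0 < eps ->
  exists d, 0 < d /\ forall x, 0 < x < d -> Rpower x q < eps.
Proof.
  intros Hq He. exists (Rpower eps (/ q)). split; [apply Rpower_pos|]. intros x Hx.
  apply Rlt_le_trans with (Rpower (Rpower eps (/ q)) q).
  - apply Rlt_Rpower_l; assumption.
  - rewrite Rpower_mult, Rinv_l by lra. rewrite Rpower_1; lra.
Qed.

Lemma Rpower_large q M : q < 0 ->
  exists d, 0 < d /\ forall x, 0 < x < d -> M < Rpower x q.
Proof.
  intros Hq. assert (HM : 0 < Rmax M 1) by (pose proof (Rmax_r M 1); lra).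
  destruct (Rpower_small (- q) (/ Rmax M 1) ltac:(lra) ltac:(apply Rinv_0_lt_compat, HM)) as (d & Hd & D).
  exists d; split; [exact Hd|]. intros x Hx. specialize (D x Hx).
  apply Rle_lt_trans with (1 := Rmax_l M 1).
  rewrite <- (Ropp_involutive q), Rpower_Ropp, <- (Rinv_inv (Rmax M 1)).
  apply Rinv_lt_contravar; [|exact D].
  apply Rmult_lt_0_compat; [apply Rpower_pos|apply Rinv_0_lt_compat, HM].
Qed.

(** [d] is chosen before [alpha] and [p], so that [alpha] may later be taken proportional to
    [|h|]. *)
Definition kinetic_scaling (k : R) (phin : R -> R) (phik : R -> R -> R -> R) : Prop :=
  forall eta, 0 < eta -> exists d, 0 < d /\
    forall h alpha p, 0 < Rabs h < d -> 0 < alpha -> 0 <= p ->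
      scaled_wave k eta (alpha * Rpower (Rabs h) (2 * p - 1)) p (phik alpha p h / h) (phin h / h).

Lemma kinetic_scaling_holds f f1 f2 f3 phin phik : concave_convex f f1 f2 f3 -> is_tangent f f1 phin ->
  (forall alpha p, 0 < alpha -> 0 <= p -> is_kinetic f phin alpha p (phik alpha p)) ->
  kinetic_scaling (f3 0 / 6) phin phik.
Proof.
  intros H Ht Hk eta He. destruct (scaled_wave_exists _ _ _ _ _ H Ht eta He) as (d & Hd & D).
  exists d; split; [exact Hd|]. intros h alpha p Hh Ha Hp.
  destruct (Hk alpha p Ha Hp) as [_ HK].
  assert (h <> 0) by (intros ->; rewrite Rabs_R0 in Hh; lra).
  destruct (HK h H0) as (B & R & _). apply D; assumption.
Qed.

(** [large_friction] bounds the ratio from below; the upper bound is that the end lies beyond the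
    tangency point. *)
Lemma ratio_strong_friction k phin phik alpha p : 0 < k -> kinetic_scaling k phin phik ->
  0 < alpha -> 0 <= p < 1/2 -> lim_ratio (fun h => phik alpha p h / h) (-1/2).
Proof.
  intros Hk KS Ha Hp eps He.
  destruct (large_friction k p (eps / 2) Hk ltac:(lra) ltac:(lra)) as (a1 & eta0 & Ha1 & Heta0 & LF).
  destruct (KS (Rmin eta0 (eps / 2)) ltac:(apply Rmin_pos; lra)) as (d1 & Hd1 & D1).
  destruct (Rpower_large (2 * p - 1) (a1 / alpha) ltac:(lra)) as (d2 & Hd2 & D2).
  exists (Rmin d1 d2). split; [apply Rmin_pos; assumption|]. intros h Hh.
  pose proof (Rmin_l d1 d2). pose proof (Rmin_r d1 d2).
  pose proof (Rmin_l eta0 (eps / 2)). pose proof (Rmin_r eta0 (eps / 2)).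
  assert (0 < Rmin eta0 (eps / 2)) by (apply Rmin_pos; lra).
  specialize (D1 h alpha p ltac:(lra) Ha ltac:(lra)). specialize (D2 (Rabs h) ltac:(lra)).
  assert (a1 <= alpha * Rpower (Rabs h) (2 * p - 1)).
  { replace a1 with (alpha * (a1 / alpha)) by (field; lra). apply Rmult_le_compat_l; lra. }
  pose proof (LF _ _ _ _ H4 ltac:(split; [exact H3|exact H1]) D1).
  destruct D1 as (Hs & _). apply Rabs_def1; lra.
Qed.

(** [small_friction] bounds the ratio from above; the lower bound is the energy inequality contained
    in [scaled_wave]. *)
Lemma ratio_weak_friction k phin phik alpha p : 0 < k -> kinetic_scaling k phin phik ->
  0 < alpha -> 1/2 < p -> lim_ratio (fun h => phik alpha p h / h) (-1).
Proof.
  intros Hk KS Ha Hp eps He.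
  destruct (small_friction k p (eps / 2) Hk ltac:(lra) ltac:(lra)) as (a1 & eta0 & Ha1 & Heta0 & LF).
  destruct (KS (Rmin eta0 (eps / 2)) ltac:(apply Rmin_pos; lra)) as (d1 & Hd1 & D1).
  destruct (Rpower_small (2 * p - 1) (a1 / alpha) ltac:(lra) ltac:(apply Rdiv_lt_0_compat; lra))
    as (d2 & Hd2 & D2).
  exists (Rmin d1 d2). split; [apply Rmin_pos; assumption|]. intros h Hh.
  pose proof (Rmin_l d1 d2). pose proof (Rmin_r d1 d2).
  pose proof (Rmin_l eta0 (eps / 2)). pose proof (Rmin_r eta0 (eps / 2)).
  assert (0 < Rmin eta0 (eps / 2)) by (apply Rmin_pos; lra).
  specialize (D1 h alpha p ltac:(lra) Ha ltac:(lra)). specialize (D2 (Rabs h) ltac:(lra)).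
  assert (0 <= alpha * Rpower (Rabs h) (2 * p - 1) <= a1).
  { split; [apply Rmult_le_pos; [lra|apply Rlt_le, Rpower_pos]|].
    replace a1 with (alpha * (a1 / alpha)) by (field; lra). apply Rmult_le_compat_l; lra. }
  pose proof (LF _ _ _ _ H4 ltac:(split; [exact H3|exact H1]) D1).
  destruct D1 as (Hs & _). apply Rabs_def1; lra.
Qed.

Lemma kinetic_scaling_half k phin phik : kinetic_scaling k phin phik ->
  forall eta, 0 < eta -> exists d, 0 < d /\
    forall h alpha, 0 < Rabs h < d -> 0 < alpha ->
      scaled_wave k eta alpha (1/2) (phik alpha (1/2) h / h) (phin h / h).
Proof.
  intros KS eta He. destruct (KS eta He) as (d & Hd & D). exists d; split; [exact Hd|].
  intros h alpha Hh Ha. specialize (D h alpha (1/2) Hh Ha ltac:(lra)).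
  replace (2 * (1/2) - 1) with 0 in D by field.
  rewrite Rpower_O, Rmult_1_r in D by lra. exact D.
Qed.

Lemma ratio_critical_bounds k phin phik alpha : 0 < k -> kinetic_scaling k phin phik -> 0 < alpha ->
  exists c d, 0 < c /\ 0 < d /\ forall h, 0 < Rabs h < d ->
    -1 + c <= phik alpha (1/2) h / h <= -1/2 - c.
Proof.
  intros Hk KS Ha.
  destruct (end_above_minus_one k alpha (1/2) Hk ltac:(lra) Ha) as (c1 & e1 & Hc1 & He1 & B1).
  destruct (end_below_minus_half k alpha Hk Ha) as (c2 & e2 & Hc2 & He2 & B2).
  pose proof (Rmin_l c1 c2). pose proof (Rmin_r c1 c2).
  pose proof (Rmin_l e1 e2). pose proof (Rmin_r e1 e2).
  assert (He : 0 < Rmin e1 e2) by (apply Rmin_pos; assumption).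
  destruct (kinetic_scaling_half _ _ _ KS _ He) as (d & Hd & D).
  exists (Rmin c1 c2), d. split; [apply Rmin_pos; assumption|]. split; [exact Hd|].
  intros h Hh. specialize (D h alpha Hh Ha).
  specialize (B1 _ _ _ ltac:(split; [exact He|exact H1]) D).
  specialize (B2 _ _ _ ltac:(split; [exact He|exact H2]) D). lra.
Qed.

(** All small [h] share the scaled friction [alpha], and their ends stay at distance [c] below -1/2,
    as [scaled_ends_close] requires. Completeness gives the limit without identifying it. *)
Lemma ratio_critical_limit k phin phik alpha : 0 < k -> kinetic_scaling k phin phik -> 0 < alpha ->
  exists L, lim_ratio (fun h => phik alpha (1/2) h / h) L.
Proof.
  intros Hk KS Ha. apply lim_ratio_cauchy. intros eps He.
  destruct (ratio_critical_bounds k phin phik alpha Hk KS Ha) as (c & d1 & Hc & Hd1 & D1).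
  assert (Hkc : 0 < k * c) by (apply Rmult_lt_0_compat; assumption).
  assert (Hkce : 0 < k * c * eps) by (apply Rmult_lt_0_compat; assumption).
  set (eta := Rmin 1 (k * c * eps / 6)).
  assert (Heta : 0 < eta /\ eta <= 1 /\ eta <= k * c * eps / 6).
  { unfold eta. split; [apply Rmin_pos; lra|]. split; [apply Rmin_l|apply Rmin_r]. }
  destruct (kinetic_scaling_half _ _ _ KS eta ltac:(lra)) as (d2 & Hd2 & D2).
  exists (Rmin d1 d2). split; [apply Rmin_pos; assumption|]. intros h1 h2 Hh1 Hh2.
  pose proof (Rmin_l d1 d2). pose proof (Rmin_r d1 d2).
  pose proof (scaled_ends_close k eta alpha (1/2) _ _ _ _ c Hk ltac:(lra) ltac:(lra) Hc ltac:(lra)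
    (D2 h1 alpha ltac:(lra) Ha) (D2 h2 alpha ltac:(lra) Ha)
    (proj2 (D1 h1 ltac:(lra))) (proj2 (D1 h2 ltac:(lra)))).
  apply Rmult_lt_reg_r with (k * c); [exact Hkc|]. lra.
Qed.

Lemma critical_slope k phin phik : 0 < k -> kinetic_scaling k phin phik ->
  exists D : R -> R,
    (forall alpha, 0 < alpha ->
       lim_ratio (fun h => phik alpha (1/2) h / h) (D alpha) /\ -1 < D alpha < -1/2) /\
    lim_0right D (-1) /\ lim_pinf D (-1/2).
Proof.
  intros Hk KS.
  assert (HD : forall alpha, exists L, 0 < alpha -> lim_ratio (fun h => phik alpha (1/2) h / h) L).
  { intros alpha. destruct (Rlt_le_dec 0 alpha) as [Ha|Ha].
    - destruct (ratio_critical_limit k phin phik alpha Hk KS Ha) as [L HL]. exists L; auto.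
    (* Arbitrary value for [alpha <= 0], where nothing is claimed. *)
    - exists 0; intros; lra. }
  set (D := fun alpha => proj1_sig (constructive_indefinite_description _ (HD alpha))).
  assert (DL : forall alpha, 0 < alpha -> lim_ratio (fun h => phik alpha (1/2) h / h) (D alpha)).
  { intros alpha. exact (proj2_sig (constructive_indefinite_description _ (HD alpha))). }
  assert (DB : forall alpha, 0 < alpha -> -1 < D alpha < -1/2).
  { intros alpha Ha.
    destruct (ratio_critical_bounds k phin phik alpha Hk KS Ha) as (c & d1 & Hc & Hd1 & D1).
    pose proof (lim_ratio_le _ _ _ _ Hd1 (fun h Hh => proj2 (D1 h Hh)) (DL alpha Ha)).
    pose proof (lim_ratio_ge _ _ _ _ Hd1 (fun h Hh => proj1 (D1 h Hh)) (DL alpha Ha)). lra. }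
  exists D. split; [intros; split; auto|]. split.
  - intros eps He.
    destruct (small_friction k (1/2) (eps / 2) Hk ltac:(lra) ltac:(lra)) as (a0 & eta0 & Ha0 & He0 & SF).
    destruct (kinetic_scaling_half _ _ _ KS eta0 He0) as (d & Hd & DD).
    exists a0; split; [exact Ha0|]. intros alpha Ha.
    assert (D alpha <= -1 + eps / 2).
    { apply (lim_ratio_le _ _ _ d Hd) with (2 := DL alpha ltac:(lra)).
      intros h Hh. apply (SF alpha eta0 _ (phin h / h)); [lra|lra|]. apply DD; [exact Hh|lra]. }
    pose proof (DB alpha ltac:(lra)). apply Rabs_def1; lra.
  - intros eps He.
    destruct (large_friction k (1/2) (eps / 2) Hk ltac:(lra) ltac:(lra)) as (a1 & eta0 & Ha1 & He0 & LF).
    destruct (kinetic_scaling_half _ _ _ KS eta0 He0) as (d & Hd & DD).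
    exists a1. intros alpha Ha.
    assert (-1/2 - eps / 2 <= D alpha).
    { apply (lim_ratio_ge _ _ _ d Hd) with (2 := DL alpha ltac:(lra)).
      intros h Hh. apply (LF alpha eta0 _ (phin h / h)); [lra|lra|]. apply DD; [exact Hh|lra]. }
    pose proof (DB alpha ltac:(lra)). apply Rabs_def1; lra.
Qed.

(** * The threshold function near the origin *)

(** With [alpha = a |h|] the scaled friction is exactly [a]. Since [A h <= alpha] means that the end
    is the tangency point, the frictions [3 c / 2 + e] and [3 c / 2 - e] enclose [A h / |h|]. *)
Lemma threshold_linear k phin phik A : 0 < k -> kinetic_scaling k phin phik ->
  is_threshold phin (fun alpha => phik alpha 0) A ->
  lim_ratio (fun h => A h / Rabs h) (3 * sqrt (k / 2) / 2).
Proof.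
  intros Hk KS (_ & _ & _ & HA) eps He. set (c := sqrt (k / 2)).
  assert (Hc : 0 < c) by (apply sqrt_lt_R0; lra).
  assert (Hck : 2 * c ^ 2 = k).
  { unfold c. replace (sqrt (k / 2) ^ 2) with (sqrt (k / 2) * sqrt (k / 2)) by ring.
    rewrite sqrt_sqrt by lra. field. }
  (* The bound [e <= c] keeps the subcritical friction [3 c / 2 - e] positive. *)
  set (e := Rmin (eps / 2) c).
  assert (Hee : 0 < e /\ e <= eps / 2 /\ e <= c)
    by (unfold e; repeat split; [apply Rmin_pos; lra|apply Rmin_l|apply Rmin_r]).
  destruct (supercritical_end c e Hc ltac:(lra)) as (e1 & He1 & S1).
  destruct (subcritical_end c e Hc ltac:(lra)) as (e2 & He2 & S2).
  rewrite Hck in *.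
  set (eta := Rmin e1 e2). assert (Heta : 0 < eta) by (apply Rmin_pos; assumption).
  pose proof (Rmin_l e1 e2) as M1. pose proof (Rmin_r e1 e2) as M2. fold eta in M1, M2.
  destruct (KS eta Heta) as (d & Hd & D). exists d; split; [exact Hd|]. intros h Hh.
  assert (Hh0 : h <> 0) by (intros ->; rewrite Rabs_R0 in Hh; lra).
  assert (SW : forall a, 0 < a ->
     scaled_wave k eta a 0 (phik (a * Rabs h) 0 h / h) (phin h / h)).
  { intros a Ha. pose proof (D h (a * Rabs h) 0 Hh ltac:(apply Rmult_lt_0_compat; lra) ltac:(lra)) as W.
    replace (2 * 0 - 1) with (Ropp 1) in W by ring.
    rewrite Rpower_Ropp, Rpower_1 in W by lra.
    replace (a * Rabs h * / Rabs h) with a in W by (field; lra). exact W. }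
  assert (Heq : forall x z, x / h = z / h -> x = z).
  { intros x z E. replace x with (x / h * h) by (field; exact Hh0). rewrite E. field. exact Hh0. }
  assert (U : A h <= (3 * c / 2 + e) * Rabs h).
  { apply (HA h Hh0); [apply Rmult_lt_0_compat; lra|]. apply Heq.
    apply (S1 eta); [lra|]. apply SW; lra. }
  assert (L : (3 * c / 2 - e) * Rabs h < A h).
  { apply Rnot_le_lt; intros HL.
    apply (HA h Hh0) in HL; [|apply Rmult_lt_0_compat; lra].
    apply (S2 eta (phik ((3 * c / 2 - e) * Rabs h) 0 h / h) (phin h / h)); [lra|apply SW; lra|].
    rewrite HL. reflexivity. }
  apply Rabs_def1; apply Rmult_lt_reg_r with (Rabs h); try lra;
    replace ((A h / Rabs h - 3 * c / 2) * Rabs h) with (A h - 3 * c / 2 * Rabs h) by (field; lra).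
  - apply Rle_lt_trans with (e * Rabs h); [lra|]. apply Rmult_lt_compat_r; lra.
  - apply Rlt_trans with (- e * Rabs h); [|lra]. apply Rmult_lt_compat_r; lra.
Qed.

(** With [alpha = M |h|] the scaled friction is [M |h|^(2p)], which tends to 0. The end ratio is
    then within 1/8 of -1 and the tangency ratio within 1/8 of -1/2, so they differ and [alpha] is
    below the threshold. *)
Lemma threshold_superlinear k phin phik A p : 0 < k -> kinetic_scaling k phin phik -> 0 < p ->
  is_threshold phin (fun alpha => phik alpha p) A ->
  forall M, exists d, 0 < d /\ forall h, 0 < Rabs h < d -> M < A h / Rabs h.
Proof.
  intros Hk KS Hp (_ & _ & _ & HA) M0. set (M := Rmax M0 1).
  assert (HM : 0 < M) by (pose proof (Rmax_r M0 1); unfold M; lra).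
  destruct (small_friction k p (1/8) Hk ltac:(lra) ltac:(lra)) as (a0 & eta0 & Ha0 & He0 & SF).
  set (eta := Rmin eta0 (1/8)). assert (Heta : 0 < eta) by (apply Rmin_pos; lra).
  pose proof (Rmin_l eta0 (1/8)) as M1. pose proof (Rmin_r eta0 (1/8)) as M2. fold eta in M1, M2.
  destruct (KS eta Heta) as (d1 & Hd1 & D1).
  destruct (Rpower_small (2 * p) (a0 / M) ltac:(lra) ltac:(apply Rdiv_lt_0_compat; lra)) as (d2 & Hd2 & D2).
  exists (Rmin d1 d2). split; [apply Rmin_pos; assumption|]. intros h Hh.
  pose proof (Rmin_l d1 d2). pose proof (Rmin_r d1 d2).
  assert (Hh0 : h <> 0) by (intros ->; rewrite Rabs_R0 in Hh; lra).
  assert (HMh : 0 < M * Rabs h) by (apply Rmult_lt_0_compat; lra).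
  specialize (D1 h (M * Rabs h) p ltac:(lra) HMh ltac:(lra)). specialize (D2 (Rabs h) ltac:(lra)).
  replace (M * Rabs h * Rpower (Rabs h) (2 * p - 1)) with (M * Rpower (Rabs h) (2 * p)) in D1.
  2:{ replace (2 * p) with (1 + (2 * p - 1)) at 1 by ring. rewrite Rpower_plus, Rpower_1 by lra. ring. }
  assert (Hs : phik (M * Rabs h) p h / h <= -1 + 1/8).
  { apply (SF (M * Rpower (Rabs h) (2 * p)) eta _ (phin h / h)); [|lra|exact D1]. split.
    - apply Rmult_le_pos; [lra|apply Rlt_le, Rpower_pos].
    - replace a0 with (M * (a0 / M)) by (field; lra). apply Rmult_le_compat_l; lra. }
  destruct D1 as (_ & Hs0 & _). apply Rabs_le_between in Hs0.
  assert (L : M * Rabs h < A h).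
  { apply Rnot_le_lt; intros HL. apply (HA h Hh0 _ HMh) in HL. rewrite HL in Hs. lra. }
  apply Rle_lt_trans with (1 := Rmax_l M0 1). fold M.
  apply Rmult_lt_reg_r with (Rabs h); [lra|].
  replace (A h / Rabs h * Rabs h) with (A h) by (field; lra). exact L.
Qed.

Theorem mainTheorem12
  (f f1 f2 f3 : R -> R) (Hf : concave_convex f f1 f2 f3)
  (phin : R -> R) (Hphin : is_tangent f f1 phin)
  (phik : R -> R -> R -> R)  (* phik alpha p = phi^flat_{alpha,p} *)
  (Hphik : forall alpha p, 0 < alpha -> 0 <= p -> is_kinetic f phin alpha p (phik alpha p))
  (A : R -> R -> R)          (* A p = A^natural_p *)
  (HA : forall p, 0 <= p <= 1/3 -> is_threshold phin (fun alpha => phik alpha p) (A p)) :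
  (* (a) p = 0 *)
  ((forall alpha, 0 < alpha -> derivable_pt_lim (phik alpha 0) 0 (-1/2)) /\
   derivable_pt_lim phin 0 (-1/2) /\
   (exists l, l <> 0 /\ lim_0right (fun u => (A 0 u - A 0 0) / u) l) /\
   (exists l, l <> 0 /\ lim_0left (fun u => (A 0 u - A 0 0) / u) l)) /\
  (* (b) 0 < p <= 1/3 *)
  (forall p, 0 < p <= 1/3 ->
     (forall alpha, 0 < alpha -> derivable_pt_lim (phik alpha p) 0 (-1/2)) /\
     to_pinf_0right (fun u => A p u / Rabs u) /\
     to_pinf_0left (fun u => A p u / Rabs u)) /\
  (* (c) 1/3 < p < 1/2 *)
  (forall p, 1/3 < p < 1/2 ->
     forall alpha, 0 < alpha -> derivable_pt_lim (phik alpha p) 0 (-1/2)) /\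
  (* (d) p = 1/2 *)
  (exists D : R -> R,
     (forall alpha, 0 < alpha ->
        derivable_pt_lim (phik alpha (1/2)) 0 (D alpha) /\ -1 < D alpha < -1/2) /\
     lim_0right D (-1) /\ lim_pinf D (-1/2)) /\
  (* (e) p > 1/2 *)
  (forall p, 1/2 < p ->
     forall alpha, 0 < alpha -> derivable_pt_lim (phik alpha p) 0 (-1)).
Proof.
  set (k := f3 0 / 6).
  assert (Hk : 0 < k) by (pose proof (cc_f3_pos _ _ _ _ Hf); unfold k; lra).
  pose proof (kinetic_scaling_holds _ _ _ _ _ _ Hf Hphin Hphik) as KS. fold k in KS.
  assert (K0 : forall alpha p, 0 < alpha -> 0 <= p -> phik alpha p 0 = 0)
    by (intros alpha p Ha Hp; apply (Hphik alpha p Ha Hp)).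
  assert (Low : forall p, 0 <= p < 1/2 -> forall alpha, 0 < alpha ->
            derivable_pt_lim (phik alpha p) 0 (-1/2)).
  { intros p Hp alpha Ha. apply lim_ratio_deriv; [apply K0; lra|].
    apply (ratio_strong_friction k phin); assumption. }
  split; [|split; [|split; [|split]]].
  - split; [intros; apply Low; lra|]. split.
    { apply lim_ratio_deriv; [apply Hphin|]. exact (phin_deriv _ _ _ _ _ Hf Hphin). }
    pose proof (HA 0 ltac:(lra)) as H0. pose proof (threshold_linear k phin phik (A 0) Hk KS H0) as TL.
    destruct H0 as (A0 & _). rewrite A0.
    assert (Hc : 0 < sqrt (k / 2)) by (apply sqrt_lt_R0; lra).
    (* The limit concerns [A 0 u / |u|], so the two one-sided derivatives are opposite. *)
    split; [exists (3 * sqrt (k / 2) / 2)|exists (- (3 * sqrt (k / 2) / 2))]; (split; [lra|]).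
    + intros eps He. destruct (TL eps He) as (d & Hd & D). exists d; split; [exact Hd|].
      intros x Hx. specialize (D x). rewrite (Rabs_right x) in D by lra. rewrite Rminus_0_r. apply D; lra.
    + intros eps He. destruct (TL eps He) as (d & Hd & D). exists d; split; [exact Hd|].
      intros x Hx. specialize (D x). rewrite (Rabs_left x) in D by lra.
      replace ((A 0 x - 0) / x - - (3 * sqrt (k / 2) / 2))
        with (- (A 0 x / - x - 3 * sqrt (k / 2) / 2)) by (field; lra).
      rewrite Rabs_Ropp. apply D; lra.
  - intros p Hp. split; [intros; apply Low; lra|].
    pose proof (threshold_superlinear k phin phik (A p) p Hk KS ltac:(lra) (HA p ltac:(lra))) as TS.
    split; intros M; destruct (TS M) as (d & Hd & D); exists d; (split; [exact Hd|]); intros x Hx; apply D.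
    + rewrite Rabs_right; lra.
    + rewrite Rabs_left; lra.
  - intros p Hp alpha Ha. apply Low; lra.
  - destruct (critical_slope k phin phik Hk KS) as (D & D1 & D2 & D3).
    exists D. split; [|split; assumption]. intros alpha Ha. destruct (D1 alpha Ha) as [DL DB].
    split; [|exact DB]. apply lim_ratio_deriv; [apply K0; lra|exact DL].
  - intros p Hp alpha Ha. apply lim_ratio_deriv; [apply K0; lra|].
    apply (ratio_weak_friction k phin); assumption.
Qed.
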